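(* Let $\mathcal C$ be a category and let $\alpha\colon \mathcal{C}\to \mathbf{B}^2\mathbb{K}^\ast$ be a 2-cocycle on $\mathcal{C}$ with values in $\mathbb{K}^\ast$. Let $J_\alpha=\iota\circ\alpha\colon\mathcal C\to 2\mathrm{Vect}_{\mathbb K}$. Then there is an equivalence between the category of projective representations of $\mathcal{C}$ of class $\alpha$ and the category of anomalous representations of $\mathcal{C}$ with anomaly $J_\alpha$. More generally, if $\xi$ is an invertible $\alpha$-structure on a functor $J\colon \mathcal{C}\to 2\mathrm{Vect}_{\mathbb K}$, then $\xi$ induces an equivalence between the category of projective representations of $\mathcal{C}$ of class $\alpha$ and the category of anomalous representations of $\mathcal{C}$ with anomaly $J$.
   Context: $\mathbb{K}$ is a field and $\mathrm{Vect}_{\mathbb K}$ is the symmetric monoidal category of finite-dimensional $\mathbb K$-vector spaces. $2\mathrm{Vect}_{\mathbb K}$ is the Morita 2-category: objects are finite-dimensional $\mathbb K$-algebras, a 1-morphism $A_0\to A_1$ is an $(A_1,A_0)$-bimodule finite-dimensional over $\mathbb K$, 2-morphisms are bimodule maps, the composite of $M_{10}\colon A_0\to A_1$ and $M_{21}\colon A_1\to A_2$ is $M_{21}\otimes_{A_1}M_{10}$, and the identity of $A$ is the bimodule $A$. ''Category'' means higher category (identified with its nerve) and ''functor'' means functor of higher categories; since all targets are 2-categories, $\mathcal C$ may be taken to be a 2-category. A 2-simplex $\Xi_{ijk}$ of $\mathcal C$ consists of 1-morphisms $f_{ij}\colon X_i\to X_j$, $f_{jk}\colon X_j\to X_k$,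 $f_{ik}\colon X_i\to X_k$ and a 2-cell $\Xi_{ijk}\colon f_{jk}\circ f_{ij}\Rightarrow f_{ik}$. A functor $J\colon\mathcal C\to 2\mathrm{Vect}_{\mathbb K}$ assigns to $X$ an algebra $J(X)$, to $f_{ij}$ a $(J(X_j),J(X_i))$-bimodule $J(f_{ij})$, with $J(\mathrm{id}_X)=J(X)$, and to each 2-simplex a bimodule map $J(\Xi_{ijk})\colon J(f_{jk})\otimes_{J(X_j)}J(f_{ij})\to J(f_{ik})$, satisfying the usual coherence on 3-simplices and units. $\mathbf{B}^2\mathbb K^\ast$ is the 2-groupoid with one object, only the identity 1-morphism, and $\mathbb K^\ast$ as its automorphism group; $\iota\colon\mathbf{B}^2\mathbb K^\ast\hookrightarrow2\mathrm{Vect}_{\mathbb K}$ sends the object to $\mathbb K$, the 1-morphism to the bimodule $\mathbb K$, and scalars to themselves. A 2-cocycle on $\mathcal C$ is a functor $\alpha\colon\mathcal C\to\mathbf{B}^2\mathbb K^\ast$, i.e. scalars $\alpha_{\Xi_{ijk}}\in\mathbb K^\ast$ for 2-simplices (equal to $1$ on degenerate ones) with $\alpha_{\Xi_{ikl}}\alpha_{\Xi_{ijk}}=\alpha_{\Xi_{ijl}}\alpha_{\Xi_{jkl}}$ for every 3-simplex. $\mathrm{Vect}_{\mathbb K}/\!/\mathbf{B}\mathbb K^\ast$ is the lax homotopy pullback of $\iota$ and the inclusion $*\to 2\mathrm{Vect}_{\mathbb K}$ of $\mathbb K$; it is the $(2,1)$-category whose 0-simplices are finite-dimensional vector spaces,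 1-simplices linear maps $\phi_{ij}\colon V_i\to V_j$, 2-simplices triples of linear maps with a scalar $\alpha_{ijk}\in\mathbb K^\ast$ such that $\phi_{jk}\circ\phi_{ij}=\alpha_{ijk}\phi_{ik}$, 3-simplices those with $\alpha_{ikl}\alpha_{ijk}=\alpha_{ijl}\alpha_{jkl}$, and whose higher simplices are determined by 3-coskeletality. It projects to $\mathbf{B}^2\mathbb K^\ast$ by remembering only the scalars. A projective representation of $\mathcal C$ of class $\alpha$ is a functor $\rho\colon\mathcal C\to \mathrm{Vect}_{\mathbb K}/\!/\mathbf{B}\mathbb K^\ast$ together with a 2-cell $\beta$ from the composite $\mathcal C\xrightarrow{\rho}\mathrm{Vect}_{\mathbb K}/\!/\mathbf{B}\mathbb K^\ast\to\mathbf{B}^2\mathbb K^\ast$ to $\alpha$. Explicitly, if $\alpha^\rho$ is the 2-cocycle of $\rho$, $\beta$ consists of scalars $\beta_{f}\in\mathbb K^\ast$ with $\alpha^\rho_{\Xi_{ijk}}\beta_{f_{ik}}=\alpha_{\Xi_{ijk}}\beta_{f_{jk}}\beta_{f_{ij}}$. Morphisms $(\rho,\beta)\to(\rho',\beta')$ are families of linear maps $h_X\colon\rho(X)\to\rho'(X)$ with $h_{X_j}\circ(\beta_{f_{ij}}^{-1}\rho(f_{ij}))=(\beta'^{-1}_{f_{ij}}\rho'(f_{ij}))\circ h_{X_i}$. Anomalous representation $Z$ of $\mathcal C$ with anomaly $J$: a lax natural transformation from the constant functor with value $\mathbb K$ to $J$. Explicitly: a (finite-dimensional) left $J(X_i)$-module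 $Z(X_i)$ for each object $X_i$; a left $J(X_j)$-module map $Z(f_{ij})\colon J(f_{ij})\otimes_{J(X_i)}Z(X_i)\to Z(X_j)$ for each $f_{ij}$ ($Z(\mathrm{id}_X)$ being the canonical isomorphism); such that $Z(f_{jk})\circ(\mathrm{id}\otimes Z(f_{ij}))=Z(f_{ik})\circ(J(\Xi_{ijk})\otimes \mathrm{id})$ for each 2-simplex. Morphisms are families of module maps $Z(X)\to Z'(X)$ compatible with the maps $Z(f_{ij}),Z'(f_{ij})$. An $\alpha$-structure $\xi$ on $J$ is a lax natural transformation $\xi\colon J\Rightarrow\iota\circ\alpha$. Explicitly: right $J(X_i)$-modules $\xi(X_i)$ and right $J(X_i)$-module maps $\xi(f_{ij})\colon\xi(X_i)\to\xi(X_j)\otimes_{J(X_j)}J(f_{ij})$ (canonical for identities) with $\alpha_{\Xi_{ijk}}\,\xi(f_{ik})=(\mathrm{id}\otimes J(\Xi_{ijk}))\circ(\xi(f_{jk})\otimes\mathrm{id})\circ\xi(f_{ij})$. It is invertible if the transformation $\xi$ is invertible, i.e. every $\xi(X)$ is an invertible $(\mathbb K,J(X))$-bimodule and every $\xi(f)$ is an isomorphism. The equivalence induced by $\xi$ sends $Z$ to the projective representation $\rho_{\xi\circ Z}$ with $\rho_{\xi\circ Z}(X_i)=\xi(X_i)\otimes_{J(X_i)}Z(X_i)$ and $\rho_{\xi\circ Z}(f_{ij})=(\mathrm{id}_{\xi(X_j)}\otimes Z(f_{ij}))\circ(\xi(f_{ij})\otimes\mathrm{id}_{Z(X_i)})$.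 *)

(* Defs.v *)
From HB Require Import structures.
From mathcomp Require Import all_boot all_order all_algebra.
From Stdlib Require Import FunctionalExtensionality ProofIrrelevance.

Set Implicit Arguments.
Unset Strict Implicit.
Unset Printing Implicit Defensive.

Import GRing.Theory.
Local Open Scope ring_scope.

Lemma linfun_linear (K : fieldType) (V U : vectType K) (f : V -> U) :
  linear f -> linfun f =1 f.
Proof.
move=> flin v.
pose F : {linear V -> U} := HB.pack f (GRing.isLinear.Build K V U *:%R f flin).
exact: (lfunE F).
Qed.

Lemma hom_linear (K : fieldType) (V U : vectType K) (f : 'Hom(V, U)) : linear f.
Proof. by move=> k x y; rewrite linearP. Qed.

Lemma homD (K : fieldType) (V U : vectType K) (f : 'Hom(V, U)) x y :
  f (x + y) = f x + f y.
Proof. exact: linearD. Qed.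

Lemma hom_app (K : fieldType) (V U : vectType K) (f g : 'Hom(V, U)) :
  f = g -> forall x, f x = g x.
Proof. by move=> ->. Qed.

Section LinearFacts.
Variables (K : fieldType) (V U : vectType K) (f : V -> U).
Hypothesis flin : linear f.

Lemma lin_pack : {F : 'Hom(V, U) | F =1 f}.
Proof. by exists (linfun f); apply: linfun_linear. Qed.

Lemma lin_D x y : f (x + y) = f x + f y.
Proof. by case: lin_pack => F E; rewrite -!E linearD. Qed.
Lemma lin_B x y : f (x - y) = f x - f y.
Proof. by case: lin_pack => F E; rewrite -!E linearB. Qed.
Lemma lin_Z k x : f (k *: x) = k *: f x.
Proof. by case: lin_pack => F E; rewrite -!E linearZ. Qed.
Lemma lin_0 : f 0 = 0.
Proof. by case: lin_pack => F E; rewrite -!E linear0. Qed.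
Lemma lin_sum I (r : seq I) (P : pred I) (g : I -> V) :
  f (\sum_(i <- r | P i) g i) = \sum_(i <- r | P i) f (g i).
Proof.
case: lin_pack => F E; rewrite -E linear_sum.
by apply: eq_bigr => i _; exact: E.
Qed.
Lemma lin_coord x : f x =
  \sum_(i < \dim {:V}) coord (vbasis {:V}) i x *: f (vbasis {:V})`_i.
Proof.
rewrite {1}(coord_vbasis (memvf x)) lin_sum.
by apply: eq_bigr => i _; rewrite lin_Z.
Qed.
End LinearFacts.

(* Finite-dimensional unital associative algebras.  The library's [falgType] is
   not used because it excludes the zero algebra. *)
Record fdalg (K : fieldType) := FdAlg {
  alg_sort :> vectType K;
  alg_mul : alg_sort -> alg_sort -> alg_sort;
  alg_one : alg_sort;
  alg_mul_linearl : forall y, linear (alg_mul ^~ y);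
  alg_mul_linearr : forall x, linear (alg_mul x);
  alg_mulA : forall x y z, alg_mul x (alg_mul y z) = alg_mul (alg_mul x y) z;
  alg_mul1l : forall x, alg_mul alg_one x = x;
  alg_mul1r : forall x, alg_mul x alg_one = x }.
Arguments alg_one {K f}.

Lemma base_mul_linearl (K : fieldType) (y : K^o) : linear (fun x : K^o => x * y).
Proof. by move=> k u v; rewrite mulrDl -scalerAl. Qed.

Lemma base_mul_linearr (K : fieldType) (x : K^o) : linear (fun y : K^o => x * y).
Proof. by move=> k u v; rewrite mulrDr; congr (_ + _); apply: mulrCA. Qed.

Definition base_alg (K : fieldType) : fdalg K :=
  @FdAlg K K^o (fun x y => x * y) 1 (@base_mul_linearl K) (@base_mul_linearr K)
    (@mulrA K) (@mul1r K) (@mulr1 K).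

(* (B, A)-bimodules.  Linearity of both actions over the same K means that K acts
   centrally; in particular a (B, K)-bimodule is just a left B-module and a
   (K, A)-bimodule just a right A-module. *)
Record bimod (K : fieldType) (B A : fdalg K) := Bimod {
  bimod_sort :> vectType K;
  lact : B -> bimod_sort -> bimod_sort;
  ract : bimod_sort -> A -> bimod_sort;
  lact_linearl : forall m, linear (lact ^~ m);
  lact_linearr : forall b, linear (lact b);
  ract_linearl : forall a, linear (ract ^~ a);
  ract_linearr : forall m, linear (ract m);
  lact1 : forall m, lact alg_one m = m;
  lactM : forall b b' m, lact (alg_mul b b') m = lact b (lact b' m);
  ract1 : forall m, ract m alg_one = m;
  ractM : forall m a a', ract m (alg_mul a a') = ract (ract m a) a';
  lractA : forall b m a, ract (lact b m) a = lact b (ract m a) }.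

Definition regular_bimod (K : fieldType) (A : fdalg K) : bimod A A :=
  @Bimod K A A A (@alg_mul K A) (@alg_mul K A)
    (@alg_mul_linearl K A) (@alg_mul_linearr K A)
    (@alg_mul_linearl K A) (@alg_mul_linearr K A)
    (@alg_mul1l K A) (fun x y z => esym (alg_mulA x y z))
    (@alg_mul1r K A) (@alg_mulA K A)
    (fun x y z => esym (alg_mulA x y z)).

Record bimod_hom (K : fieldType) (B A : fdalg K) (M N : bimod B A) := BimodHom {
  bimod_lfun :> 'Hom(M, N);
  bimod_homL : forall b m, bimod_lfun (lact b m) = lact b (bimod_lfun m);
  bimod_homR : forall m a, bimod_lfun (ract m a) = ract (bimod_lfun m) a }.

Lemma bimod_hom_eq (K : fieldType) (B A : fdalg K) (M N : bimod B A)
  (f g : bimod_hom M N) : bimod_lfun f = bimod_lfun g -> f = g.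
Proof.
case: f g => [f fl fr] [g gl gr] /= e; subst g.
by congr BimodHom; apply: proof_irrelevance.
Qed.

Section BimodHomOps.
Variables (K : fieldType) (B A : fdalg K).

Lemma bimod_id_subproof (M : bimod B A) :
  (forall b m, (\1%VF : 'End(M)) (lact b m) = lact b ((\1%VF : 'End(M)) m)) *
  (forall m a, (\1%VF : 'End(M)) (ract m a) = ract ((\1%VF : 'End(M)) m) a).
Proof. by split=> *; rewrite !id_lfunE. Qed.

Definition bimod_id (M : bimod B A) : bimod_hom M M :=
  BimodHom (bimod_id_subproof M).1 (bimod_id_subproof M).2.

Lemma bimod_comp_subproof (M N P : bimod B A)
    (g : bimod_hom N P) (f : bimod_hom M N) :
  (forall b m, (g \o f)%VF (lact b m) = lact b ((g \o f)%VF m)) *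
  (forall m a, (g \o f)%VF (ract m a) = ract ((g \o f)%VF m) a).
Proof. by split=> *; rewrite !comp_lfunE /= ?bimod_homL ?bimod_homR. Qed.

Definition bimod_comp (M N P : bimod B A)
    (g : bimod_hom N P) (f : bimod_hom M N) : bimod_hom M P :=
  BimodHom (bimod_comp_subproof g f).1 (bimod_comp_subproof g f).2.

Definition bimod_isom (M N : bimod B A) : Prop :=
  exists f : bimod_hom M N, bijective f.

End BimodHomOps.

(* The quotient of a vector space V by a subspace R, realised on a complement. *)
Section Quotient.

Variables (K : fieldType) (V : vectType K) (R : {vspace V}).

Definition quotv : vectType K := subvs_of (R^C)%VS.

Definition quotv_proj (t : V) : quotv := vsproj (R^C)%VS (t - projv R t).

Definition quotv_repr (t : quotv) : V := vsval t.

Lemma quotv_proj_linear : linear quotv_proj.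
Proof. by move=> k s t; rewrite /quotv_proj linearP opprD addrACA -scalerBr linearP. Qed.

Lemma quotv_repr_linear : linear quotv_repr.
Proof. by move=> k s t; rewrite /quotv_repr linearP. Qed.

Lemma quotv_capC : (R^C :&: R = 0)%VS.
Proof. by rewrite capvC capv_compl. Qed.

Lemma quotv_projK t : t - quotv_repr (quotv_proj t) \in R.
Proof.
rewrite /quotv_repr /quotv_proj vsprojK; last exact: memv_projC.
by rewrite opprB addrCA subrr addr0 memv_proj.
Qed.

Lemma quotv_proj0 t : t \in R -> quotv_proj t = 0.
Proof.
move=> tR; apply/val_inj/eqP; rewrite -[_ == _]/(quotv_repr (quotv_proj t) == 0).
rewrite -memv0 -quotv_capC memv_cap subvsP /=.
by have := memvB tR (quotv_projK t); rewrite opprB addrC subrK.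
Qed.

Lemma quotv_reprK t : quotv_proj (quotv_repr t) = t.
Proof.
apply/val_inj/eqP; rewrite eq_sym -subr_eq0 -memv0 -quotv_capC memv_cap.
by rewrite [X in _ && X]quotv_projK andbT memvB // subvsP.
Qed.

End Quotient.

(* The tensor product of M and N over B, realised on a complement of the
   subspace of relations in the space of coefficient matrices, which is the
   tensor product over K.  [tsp_lift], [tsp_liftE] and [tsp_ext] give its
   universal property. *)
Section TensorProduct.

Variables (K : fieldType) (C B A : fdalg K) (M : bimod C B) (N : bimod B A).

Local Notation e V i := ((vbasis {:V})`_i).

Definition kron_sp : vectType K := [the vectType K of 'M[K]_(\dim {:M}, \dim {:N})].

Definition kron (m : M) (n : N) : kron_sp :=
  \matrix_(i, j) (coord (vbasis {:M}) i m * coord (vbasis {:N}) j n).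

Definition tens_rel : {vspace kron_sp} :=
  (\sum_(i < \dim {:M}) \sum_(k < \dim {:B}) \sum_(j < \dim {:N})
     <[kron (ract (e M i) (e B k)) (e N j)
       - kron (e M i) (lact (e B k) (e N j))]>)%VS.

Definition tens_sp : vectType K := quotv tens_rel.

Definition tsp_pure (m : M) (n : N) : tens_sp :=
  quotv_proj tens_rel (kron m n).

Definition balanced (U : vectType K) (b : M -> N -> U) : Prop :=
  [/\ forall n, linear (b ^~ n), forall m, linear (b m)
    & forall m x n, b (ract m x) n = b m (lact x n)].

Definition mxlift (U : vectType K) (b : M -> N -> U)
    (t : kron_sp) : U :=
  \sum_i \sum_j t i j *: b (e M i) (e N j).

Definition tsp_lift (U : vectType K) (b : M -> N -> U) : 'Hom(tens_sp, U) :=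
  linfun (fun t : tens_sp => mxlift b (quotv_repr t)).

Lemma kron_linearl n : linear (kron ^~ n).
Proof. by move=> k x y; apply/matrixP => i j; rewrite !mxE linearP mulrDl mulrA. Qed.

Lemma kron_linearr m : linear (kron m).
Proof.
move=> k x y; apply/matrixP => i j; rewrite !mxE linearP mulrDr.
by congr (_ + _); rewrite /= mulrCA.
Qed.

Lemma mxlift_linear (U : vectType K) (b : M -> N -> U) : linear (mxlift b).
Proof.
move=> k s t; rewrite /mxlift scaler_sumr -big_split; apply: eq_bigr => i _.
rewrite /= scaler_sumr -big_split; apply: eq_bigr => j _ /=.
by rewrite !mxE scalerDl scalerA.
Qed.

Lemma tsp_lift_val (U : vectType K) (b : M -> N -> U) (t : tens_sp) :
  tsp_lift b t = mxlift b (quotv_repr t).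
Proof.
rewrite /tsp_lift linfun_linear // => k x y.
by rewrite quotv_repr_linear mxlift_linear.
Qed.

Lemma bilinear_coord (U : vectType K) (b : M -> N -> U) m n :
    (forall n, linear (b ^~ n)) -> (forall m, linear (b m)) ->
  b m n = mxlift b (kron m n).
Proof.
move=> bl br; rewrite (lin_coord (bl n)); apply: eq_bigr => i _.
rewrite (lin_coord (br _)) scaler_sumr; apply: eq_bigr => j _.
by rewrite mxE scalerA.
Qed.

Lemma mxlift_rel (U : vectType K) (b : M -> N -> U) t :
  balanced b -> t \in tens_rel -> mxlift b t = 0.
Proof.
case=> bl br bb; case: (lin_pack (@mxlift_linear U b)) => F E.
move=> tR; rewrite -E; apply/eqP; rewrite -memv_ker.
apply: subvP t tR; apply/subv_sumP => i _; apply/subv_sumP => k _.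
apply/subv_sumP => j _; rewrite -memvE memv_ker linearB /= !E.
by rewrite -!bilinear_coord // bb subrr.
Qed.

Lemma tens_rel_sub m x n :
  kron (ract m x) n - kron m (lact x n) \in tens_rel.
Proof.
pose c (i : 'I_(\dim {:M})) (k : 'I_(\dim {:B})) (j : 'I_(\dim {:N})) :=
  kron (ract (e M i) (e B k)) (e N j)
       - kron (e M i) (lact (e B k) (e N j)).
have cR i k j : c i k j \in tens_rel.
  rewrite memvE; apply: (sumv_sup i) => //.
  by apply: (sumv_sup k) => //; apply: (sumv_sup j).
pose d m x n := kron (ract m x) n - kron m (lact x n).
have d1 x0 n0 : linear (fun m => d m x0 n0).
  move=> k u v; rewrite /d ract_linearl !kron_linearl scalerBr.
  by rewrite opprD addrACA.
have d2 m0 n0 : linear (fun x => d m0 x n0).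
  move=> k u v; rewrite /d ract_linearr lact_linearl kron_linearl kron_linearr.
  by rewrite scalerBr opprD addrACA.
have d3 m0 x0 : linear (fun n => d m0 x0 n).
  move=> k u v; rewrite /d lact_linearr !kron_linearr scalerBr.
  by rewrite opprD addrACA.
rewrite -[_ - _]/(d m x n) (lin_coord (d1 x n)).
apply: memv_suml => i _; apply: memvZ.
rewrite (lin_coord (d2 _ n)); apply: memv_suml => k _; apply: memvZ.
rewrite (lin_coord (d3 _ _)); apply: memv_suml => j _; apply: memvZ.
exact: cR.
Qed.

Lemma tsp_pure_linearl n : linear (tsp_pure ^~ n).
Proof. by move=> k x y; rewrite /tsp_pure kron_linearl quotv_proj_linear. Qed.

Lemma tsp_pure_linearr m : linear (tsp_pure m).
Proof. by move=> k x y; rewrite /tsp_pure kron_linearr quotv_proj_linear. Qed.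

Lemma tsp_pure_bal m x n : tsp_pure (ract m x) n = tsp_pure m (lact x n).
Proof.
apply/eqP; rewrite -subr_eq0 -(lin_B (@quotv_proj_linear _ _ _)).
by rewrite quotv_proj0 // tens_rel_sub.
Qed.

Lemma tsp_liftE (U : vectType K) (b : M -> N -> U) m n :
  balanced b -> tsp_lift b (tsp_pure m n) = b m n.
Proof.
move=> bb; rewrite tsp_lift_val; case: (bb) => bl br _.
rewrite (bilinear_coord m n bl br); apply/esym/eqP; rewrite -subr_eq0.
rewrite -(lin_B (@mxlift_linear U b)) mxlift_rel //; exact: quotv_projK.
Qed.

Lemma mxlift_kron (t : kron_sp) : mxlift kron t = t.
Proof.
have ce (V : vectType K) (i j : 'I_(\dim {:V})) :
    coord (vbasis {:V}) i (e V j) = (j == i)%:R.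
  by rewrite coord_free ?(basis_free (vbasisP _)) // eq_sym.
apply/matrixP => i j; rewrite /mxlift summxE (bigD1 i) //= [X in _ + X]big1.
  rewrite addr0 summxE (bigD1 j) //= [X in _ + X]big1.
    by rewrite addr0 !mxE !ce !eqxx !mulr1.
  by move=> j' j'j; rewrite !mxE !ce (negPf j'j) !mulr0.
move=> i' i'i; rewrite summxE big1 // => j' _.
by rewrite !mxE !ce (negPf i'i) mul0r mulr0.
Qed.

Lemma tsp_sum (t : tens_sp) :
  t = \sum_i \sum_j tsp_pure (quotv_repr t i j *: e M i) (e N j).
Proof.
rewrite -{1}[t]quotv_reprK -{1}[quotv_repr t]mxlift_kron.
rewrite /mxlift (lin_sum (@quotv_proj_linear _ _ _)); apply: eq_bigr => i _.
rewrite (lin_sum (@quotv_proj_linear _ _ _)); apply: eq_bigr => j _.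
by rewrite (lin_Z (@quotv_proj_linear _ _ _)) (lin_Z (@tsp_pure_linearl _)).
Qed.

Lemma tsp_ind (P : tens_sp -> Prop) :
    (forall m n, P (tsp_pure m n)) -> (forall s t, P s -> P t -> P (s + t)) ->
  forall t, P t.
Proof.
move=> Pp PD t; rewrite (tsp_sum t).
have P0 : P 0 by rewrite -(lin_0 (@tsp_pure_linearr 0)).
by elim/big_ind: _ => // i _; elim/big_ind: _.
Qed.

Definition tsp_lact (c : C) : 'Hom(tens_sp, tens_sp) :=
  tsp_lift (fun m n => tsp_pure (lact c m) n).

Definition tsp_ract (a : A) : 'Hom(tens_sp, tens_sp) :=
  tsp_lift (fun m n => tsp_pure m (ract n a)).

Lemma tsp_lactE c m n : tsp_lact c (tsp_pure m n) = tsp_pure (lact c m) n.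
Proof.
rewrite tsp_liftE //; split=> [n' k x y|m' k x y|m' x n'].
- by rewrite lact_linearr tsp_pure_linearl.
- exact: tsp_pure_linearr.
- by rewrite -lractA tsp_pure_bal.
Qed.

Lemma tsp_ractE a m n : tsp_ract a (tsp_pure m n) = tsp_pure m (ract n a).
Proof.
rewrite tsp_liftE //; split=> [n' k x y|m' k x y|m' x n'].
- exact: tsp_pure_linearl.
- by rewrite ract_linearl tsp_pure_linearr.
- by rewrite tsp_pure_bal -lractA.
Qed.

Lemma tsp_lact_linearl t : linear (fun c => tsp_lact c t).
Proof.
move=> k x y; elim/tsp_ind: t => [m n|s t es et].
  by rewrite !tsp_lactE lact_linearl tsp_pure_linearl.
by rewrite !homD es et scalerDr addrACA.
Qed.

Lemma tsp_ract_linearr t : linear (fun a => tsp_ract a t).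
Proof.
move=> k x y; elim/tsp_ind: t => [m n|s t es et].
  by rewrite !tsp_ractE ract_linearr tsp_pure_linearr.
by rewrite !homD es et scalerDr addrACA.
Qed.

Lemma tsp_lact1 t : tsp_lact alg_one t = t.
Proof.
elim/tsp_ind: t => [m n|s t es et]; first by rewrite tsp_lactE lact1.
by rewrite homD es et.
Qed.

Lemma tsp_lactM c c' t :
  tsp_lact (alg_mul c c') t = tsp_lact c (tsp_lact c' t).
Proof.
elim/tsp_ind: t => [m n|s t es et]; first by rewrite !tsp_lactE lactM.
by rewrite !homD es et.
Qed.

Lemma tsp_ract1 t : tsp_ract alg_one t = t.
Proof.
elim/tsp_ind: t => [m n|s t es et]; first by rewrite tsp_ractE ract1.
by rewrite homD es et.
Qed.

Lemma tsp_ractM t a a' :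
  tsp_ract (alg_mul a a') t = tsp_ract a' (tsp_ract a t).
Proof.
elim/tsp_ind: t => [m n|s t es et]; first by rewrite !tsp_ractE ractM.
by rewrite !homD es et.
Qed.

Lemma tsp_lractA c t a :
  tsp_ract a (tsp_lact c t) = tsp_lact c (tsp_ract a t).
Proof.
elim/tsp_ind: t => [m n|s t es et].
  by rewrite !(tsp_ractE, tsp_lactE).
by rewrite !homD es et.
Qed.

Definition tens : bimod C A :=
  @Bimod K C A tens_sp (fun c t => tsp_lact c t) (fun t a => tsp_ract a t)
    tsp_lact_linearl (fun c => @hom_linear _ _ _ (tsp_lact c))
    (fun a => @hom_linear _ _ _ (tsp_ract a)) tsp_ract_linearr
    tsp_lact1 tsp_lactM tsp_ract1 tsp_ractM tsp_lractA.

Definition pure (m : M) (n : N) : tens := tsp_pure m n.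

Definition tens_lift (U : vectType K) (b : M -> N -> U) : 'Hom(tens, U) :=
  tsp_lift b.

Lemma pure_linearl n : linear (pure ^~ n).
Proof. exact: tsp_pure_linearl. Qed.

Lemma pure_linearr m : linear (pure m).
Proof. exact: tsp_pure_linearr. Qed.

Lemma pure_bal m x n : pure (ract m x) n = pure m (lact x n).
Proof. exact: tsp_pure_bal. Qed.

Lemma lact_pure c m n : lact c (pure m n) = pure (lact c m) n.
Proof. exact: tsp_lactE. Qed.

Lemma ract_pure m n a : ract (pure m n) a = pure m (ract n a).
Proof. exact: tsp_ractE. Qed.

Lemma tens_liftE (U : vectType K) (b : M -> N -> U) m n :
  balanced b -> tens_lift b (pure m n) = b m n.
Proof. exact: tsp_liftE. Qed.

Lemma tens_ind (P : tens -> Prop) :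
    (forall m n, P (pure m n)) -> (forall s t, P s -> P t -> P (s + t)) ->
  forall t, P t.
Proof. exact: tsp_ind. Qed.

Lemma tens_ext (U : vectType K) (f g : 'Hom(tens, U)) :
  (forall m n, f (pure m n) = g (pure m n)) -> f = g.
Proof.
move=> fg; apply/lfunP; elim/tens_ind => // s t es et.
by rewrite !homD es et.
Qed.

End TensorProduct.

Notation "M ⊗ N" := (tens M N) (at level 40, left associativity).

(* Bimodule maps out of M ⊗ N, from balanced maps that respect both actions. *)
Section TensorMaps.

Variables (K : fieldType).

Lemma tens_lift_homL (C B A : fdalg K) (M : bimod C B) (N : bimod B A)
    (P : bimod C A) (b : M -> N -> P) :
  balanced b -> (forall c m n, b (lact c m) n = lact c (b m n)) ->
  forall c (t : M ⊗ N), tens_lift b (lact c t) = lact c (tens_lift b t).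
Proof.
move=> bb bL c; elim/tens_ind => [m n|s t es et].
  by rewrite !lact_pure !tens_liftE.
by rewrite (lin_D (lact_linearr c)) !homD (lin_D (lact_linearr c)) es et.
Qed.

Lemma tens_lift_homR (C B A : fdalg K) (M : bimod C B) (N : bimod B A)
    (P : bimod C A) (b : M -> N -> P) :
  balanced b -> (forall m n a, b m (ract n a) = ract (b m n) a) ->
  forall (t : M ⊗ N) a, tens_lift b (ract t a) = ract (tens_lift b t) a.
Proof.
move=> bb bR t a; elim/tens_ind: t => [m n|s t es et].
  by rewrite !ract_pure !tens_liftE.
by rewrite (lin_D (ract_linearl a)) !homD (lin_D (ract_linearl a)) es et.
Qed.

Definition tens_hom (C B A : fdalg K) (M : bimod C B) (N : bimod B A)
    (P : bimod C A) (b : M -> N -> P) (bb : balanced b)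
    (bL : forall c m n, b (lact c m) n = lact c (b m n))
    (bR : forall m n a, b m (ract n a) = ract (b m n) a) :
    bimod_hom (M ⊗ N) P :=
  @BimodHom K C A (M ⊗ N) P (tens_lift b)
    (tens_lift_homL bb bL) (tens_lift_homR bb bR).

Section Map.
Variables (C B A : fdalg K) (M M' : bimod C B) (N N' : bimod B A).
Variables (f : bimod_hom M M') (g : bimod_hom N N').

Let b (m : M) (n : N) : M' ⊗ N' := pure (f m) (g n).

Lemma tens_map_balanced : balanced b.
Proof.
split=> [n k x y|m k x y|m x n]; rewrite /b.
- by rewrite linearP pure_linearl.
- by rewrite linearP pure_linearr.
- by rewrite bimod_homL bimod_homR pure_bal.
Qed.

Lemma tens_map_L c m n : b (lact c m) n = lact c (b m n).
Proof. by rewrite /b !lact_pure bimod_homL. Qed.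

Lemma tens_map_R m n a : b m (ract n a) = ract (b m n) a.
Proof. by rewrite /b !ract_pure bimod_homR. Qed.

(* f ⊗ g *)
Definition tens_map : bimod_hom (M ⊗ N) (M' ⊗ N') :=
  tens_hom tens_map_balanced tens_map_L tens_map_R.

Lemma tens_mapE m n : tens_map (pure m n) = pure (f m) (g n).
Proof. exact: tens_liftE tens_map_balanced. Qed.

End Map.

Section Unitors.
Variables (B A : fdalg K) (M : bimod B A).

Lemma tens_unitl_balanced : balanced (fun (b : regular_bimod B) (m : M) => lact b m).
Proof.
split=> [m|b|b x m]; [exact: lact_linearl|exact: lact_linearr|exact: lactM].
Qed.

(* b ⊗ m |-> b m *)
Definition tens_unitl : bimod_hom (tens (regular_bimod B) M) M :=
  tens_hom tens_unitl_balanced (fun c b m => lactM c b m)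
    (fun b m a => esym (lractA b m a)).

Lemma tens_unitlE b m : tens_unitl (pure b m) = lact b m.
Proof. exact: tens_liftE tens_unitl_balanced. Qed.

Lemma tens_unitr_balanced : balanced (fun (m : M) (a : regular_bimod A) => ract m a).
Proof.
split=> [a|m|m x a]; [exact: ract_linearl|exact: ract_linearr|].
by rewrite /= ractM.
Qed.

(* m ⊗ a |-> m a *)
Definition tens_unitr : bimod_hom (tens M (regular_bimod A)) M :=
  tens_hom tens_unitr_balanced (fun c m a => lractA c m a)
    (fun m a a' => ractM m a a').

Lemma tens_unitrE m a : tens_unitr (pure m a) = ract m a.
Proof. exact: tens_liftE tens_unitr_balanced. Qed.

End Unitors.

Section Associator.
Variables (D C B A : fdalg K) (M : bimod D C) (N : bimod C B) (P : bimod B A).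

Lemma tens_assoc_balanced1 p :
  balanced (fun (m : M) (n : N) => pure m (pure n p) : M ⊗ (N ⊗ P)).
Proof.
split=> [n|m k x y|m x n]; first exact: pure_linearl.
- by rewrite pure_linearl pure_linearr.
- by rewrite pure_bal !lact_pure.
Qed.

Let b (t : M ⊗ N) (p : P) : M ⊗ (N ⊗ P) :=
  tens_lift (fun (m : M) (n : N) => pure m (pure n p)) t.

Let bE m n p : b (pure m n) p = pure m (pure n p).
Proof. exact: tens_liftE (tens_assoc_balanced1 p). Qed.

Let bD s t p : b (s + t) p = b s p + b t p.
Proof. exact: homD. Qed.

Lemma tens_assoc_balanced : balanced b.
Proof.
split=> [p|t k x y|t x p]; first exact: hom_linear.
- elim/tens_ind: t => [m n|s t es et]; first by rewrite !bE !pure_linearr.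
  by rewrite !bD es et scalerDr addrACA.
- elim/tens_ind: t => [m n|s t es et].
    by rewrite !ract_pure !bE pure_bal.
  by rewrite (lin_D (ract_linearl x)) !bD es et.
Qed.

Lemma tens_assoc_L d t p : b (lact d t) p = lact d (b t p).
Proof.
elim/tens_ind: t => [m n|s t es et]; first by rewrite !lact_pure !bE lact_pure.
by rewrite (lin_D (lact_linearr d)) !bD
  (lin_D (lact_linearr d)) es et.
Qed.

Lemma tens_assoc_R t p a : b t (ract p a) = ract (b t p) a.
Proof.
elim/tens_ind: t => [m n|s t es et]; first by rewrite !bE !ract_pure.
by rewrite !bD (lin_D (ract_linearl a)) es et.
Qed.

(* (m ⊗ n) ⊗ p |-> m ⊗ (n ⊗ p) *)
Definition tens_assoc : bimod_hom (M ⊗ N ⊗ P) (M ⊗ (N ⊗ P)) :=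
  tens_hom tens_assoc_balanced tens_assoc_L tens_assoc_R.

Lemma tens_assocE m n p :
  tens_assoc (pure (pure m n) p) = pure m (pure n p).
Proof. by rewrite [LHS]tens_liftE ?bE //; exact: tens_assoc_balanced. Qed.

End Associator.

End TensorMaps.

#[global] Opaque tens pure tens_lift tens_map tens_unitl tens_unitr tens_assoc.

(* Bicategories; [comp1 g f] is f followed by g, [lwhisker g u] and
   [rwhisker u f] are the whiskerings of u by g and by f. *)
Record bicategory := Bicategory {
  ob :> Type;
  cell1 : ob -> ob -> Type;
  cell2 : forall X Y, cell1 X Y -> cell1 X Y -> Type;
  id1 : forall X, cell1 X X;
  comp1 : forall X Y Z, cell1 Y Z -> cell1 X Y -> cell1 X Z;
  id2 : forall X Y (f : cell1 X Y), cell2 f f;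
  vcomp : forall X Y (f g h : cell1 X Y), cell2 g h -> cell2 f g -> cell2 f h;
  lwhisker : forall X Y Z (g : cell1 Y Z) (f f' : cell1 X Y),
    cell2 f f' -> cell2 (comp1 g f) (comp1 g f');
  rwhisker : forall X Y Z (g g' : cell1 Y Z), cell2 g g' ->
    forall f : cell1 X Y, cell2 (comp1 g f) (comp1 g' f);
  assoc : forall W X Y Z (h : cell1 Y Z) (g : cell1 X Y) (f : cell1 W X),
    cell2 (comp1 (comp1 h g) f) (comp1 h (comp1 g f));
  assocV : forall W X Y Z (h : cell1 Y Z) (g : cell1 X Y) (f : cell1 W X),
    cell2 (comp1 h (comp1 g f)) (comp1 (comp1 h g) f);
  lunit : forall X Y (f : cell1 X Y), cell2 (comp1 (id1 Y) f) f;
  lunitV : forall X Y (f : cell1 X Y), cell2 f (comp1 (id1 Y) f);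
  runit : forall X Y (f : cell1 X Y), cell2 (comp1 f (id1 X)) f;
  runitV : forall X Y (f : cell1 X Y), cell2 f (comp1 f (id1 X));
  vcomp1l : forall X Y (f g : cell1 X Y) (u : cell2 f g), vcomp (id2 g) u = u;
  vcomp1r : forall X Y (f g : cell1 X Y) (u : cell2 f g), vcomp u (id2 f) = u;
  vcompA : forall X Y (f g h k : cell1 X Y)
    (w : cell2 h k) (v : cell2 g h) (u : cell2 f g),
    vcomp w (vcomp v u) = vcomp (vcomp w v) u;
  lwhisker_id : forall X Y Z (g : cell1 Y Z) (f : cell1 X Y),
    lwhisker g (id2 f) = id2 (comp1 g f);
  rwhisker_id : forall X Y Z (g : cell1 Y Z) (f : cell1 X Y),
    rwhisker (id2 g) f = id2 (comp1 g f);
  lwhisker_comp : forall X Y Z (g : cell1 Y Z) (f f' f'' : cell1 X Y)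
    (v : cell2 f' f'') (u : cell2 f f'),
    lwhisker g (vcomp v u) = vcomp (lwhisker g v) (lwhisker g u);
  rwhisker_comp : forall X Y Z (g g' g'' : cell1 Y Z)
    (v : cell2 g' g'') (u : cell2 g g') (f : cell1 X Y),
    rwhisker (vcomp v u) f = vcomp (rwhisker v f) (rwhisker u f);
  whisker_interchange : forall X Y Z (g g' : cell1 Y Z) (f f' : cell1 X Y)
    (v : cell2 g g') (u : cell2 f f'),
    vcomp (rwhisker v f') (lwhisker g u) = vcomp (lwhisker g' u) (rwhisker v f);
  assocK : forall W X Y Z (h : cell1 Y Z) (g : cell1 X Y) (f : cell1 W X),
    vcomp (assocV h g f) (assoc h g f) = id2 _;
  assocVK : forall W X Y Z (h : cell1 Y Z) (g : cell1 X Y) (f : cell1 W X),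
    vcomp (assoc h g f) (assocV h g f) = id2 _;
  lunitK : forall X Y (f : cell1 X Y), vcomp (lunitV f) (lunit f) = id2 _;
  lunitVK : forall X Y (f : cell1 X Y), vcomp (lunit f) (lunitV f) = id2 _;
  runitK : forall X Y (f : cell1 X Y), vcomp (runitV f) (runit f) = id2 _;
  runitVK : forall X Y (f : cell1 X Y), vcomp (runit f) (runitV f) = id2 _;
  assoc_natl : forall W X Y Z (h h' : cell1 Y Z) (u : cell2 h h')
    (g : cell1 X Y) (f : cell1 W X),
    vcomp (assoc h' g f) (rwhisker (rwhisker u g) f) =
    vcomp (rwhisker u (comp1 g f)) (assoc h g f);
  assoc_natm : forall W X Y Z (h : cell1 Y Z) (g g' : cell1 X Y)
    (u : cell2 g g') (f : cell1 W X),
    vcomp (assoc h g' f) (rwhisker (lwhisker h u) f) =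
    vcomp (lwhisker h (rwhisker u f)) (assoc h g f);
  assoc_natr : forall W X Y Z (h : cell1 Y Z) (g : cell1 X Y)
    (f f' : cell1 W X) (u : cell2 f f'),
    vcomp (assoc h g f') (lwhisker (comp1 h g) u) =
    vcomp (lwhisker h (lwhisker g u)) (assoc h g f);
  lunit_nat : forall X Y (f f' : cell1 X Y) (u : cell2 f f'),
    vcomp (lunit f') (lwhisker (id1 Y) u) = vcomp u (lunit f);
  runit_nat : forall X Y (f f' : cell1 X Y) (u : cell2 f f'),
    vcomp (runit f') (rwhisker u (id1 X)) = vcomp u (runit f);
  pentagon : forall V W X Y Z (k : cell1 Y Z) (h : cell1 X Y)
    (g : cell1 W X) (f : cell1 V W),
    vcomp (lwhisker k (assoc h g f))
      (vcomp (assoc k (comp1 h g) f) (rwhisker (assoc k h g) f)) =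
    vcomp (assoc k h (comp1 g f)) (assoc (comp1 k h) g f);
  triangle : forall X Y Z (g : cell1 Y Z) (f : cell1 X Y),
    vcomp (lwhisker g (lunit f)) (assoc g (id1 Y) f) = rwhisker (runit g) f }.

Arguments id1 {b} X.

(* The 2-simplices of (the nerve of) C with edges f, g and h; the degenerate
   ones are the unitors [runit f] and [lunit f]. *)
Definition simplex2 (C : bicategory) (X Y Z : C)
  (f : cell1 X Y) (g : cell1 Y Z) (h : cell1 X Z) : Type := cell2 (comp1 g f) h.

(* The 2-simplices u012, u023, u013 and u123 bound a 3-simplex of (the nerve
   of) C. *)
Definition simplex3 (C : bicategory) (X0 X1 X2 X3 : C)
    (f01 : cell1 X0 X1) (f12 : cell1 X1 X2) (f23 : cell1 X2 X3)
    (f02 : cell1 X0 X2) (f13 : cell1 X1 X3) (f03 : cell1 X0 X3)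
    (u012 : simplex2 f01 f12 f02) (u023 : simplex2 f02 f23 f03)
    (u013 : simplex2 f01 f13 f03) (u123 : simplex2 f12 f23 f13) : Prop :=
  vcomp u023 (vcomp (lwhisker f23 u012) (assoc f23 f12 f01)) =
  vcomp u013 (rwhisker u123 f01).

(* Functors from C to B^2 K^*. *)
Record cocycle (K : fieldType) (C : bicategory) := Cocycle {
  cocycle_val : forall (X Y Z : C) (f : cell1 X Y) (g : cell1 Y Z)
    (h : cell1 X Z), simplex2 f g h -> K;
  cocycle_neq0 : forall (X Y Z : C) (f : cell1 X Y) (g : cell1 Y Z)
    (h : cell1 X Z) (u : simplex2 f g h), cocycle_val u != 0;
  cocycle_runit : forall (X Y : C) (f : cell1 X Y),
    cocycle_val (runit f : simplex2 (id1 X) f f) = 1;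
  cocycle_lunit : forall (X Y : C) (f : cell1 X Y),
    cocycle_val (lunit f : simplex2 f (id1 Y) f) = 1;
  cocycle3 : forall (X0 X1 X2 X3 : C)
    (f01 : cell1 X0 X1) (f12 : cell1 X1 X2) (f23 : cell1 X2 X3)
    (f02 : cell1 X0 X2) (f13 : cell1 X1 X3) (f03 : cell1 X0 X3)
    (u012 : simplex2 f01 f12 f02) (u023 : simplex2 f02 f23 f03)
    (u013 : simplex2 f01 f13 f03) (u123 : simplex2 f12 f23 f13),
    simplex3 u012 u023 u013 u123 ->
    cocycle_val u023 * cocycle_val u012 = cocycle_val u013 * cocycle_val u123 }.

(* Functors from C to 2Vect.  The identification of J(id_X) with J(X) is a given
   isomorphism [fun2v_unit X] rather than an equality of bimodules. *)
Record fun2vect (K : fieldType) (C : bicategory) := Fun2Vect {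
  fun2v_alg :> C -> fdalg K;
  fun2v_bimod : forall X Y : C, cell1 X Y -> bimod (fun2v_alg Y) (fun2v_alg X);
  fun2v_unit : forall X : C,
    bimod_hom (regular_bimod (fun2v_alg X)) (fun2v_bimod (id1 X));
  fun2v_hom : forall (X Y Z : C) (f : cell1 X Y) (g : cell1 Y Z)
    (h : cell1 X Z), simplex2 f g h ->
    bimod_hom (fun2v_bimod g ⊗ fun2v_bimod f) (fun2v_bimod h);
  fun2v_unit_bij : forall X, bijective (fun2v_unit X);
  fun2v_runit : forall (X Y : C) (f : cell1 X Y),
    (fun2v_hom (runit f : simplex2 (id1 X) f f)
       \o tens_map (bimod_id (fun2v_bimod f)) (fun2v_unit X))%VF =
    tens_unitr (fun2v_bimod f);
  fun2v_lunit : forall (X Y : C) (f : cell1 X Y),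
    (fun2v_hom (lunit f : simplex2 f (id1 Y) f)
       \o tens_map (fun2v_unit Y) (bimod_id (fun2v_bimod f)))%VF =
    tens_unitl (fun2v_bimod f);
  fun2v3 : forall (X0 X1 X2 X3 : C)
    (f01 : cell1 X0 X1) (f12 : cell1 X1 X2) (f23 : cell1 X2 X3)
    (f02 : cell1 X0 X2) (f13 : cell1 X1 X3) (f03 : cell1 X0 X3)
    (u012 : simplex2 f01 f12 f02) (u023 : simplex2 f02 f23 f03)
    (u013 : simplex2 f01 f13 f03) (u123 : simplex2 f12 f23 f13),
    simplex3 u012 u023 u013 u123 ->
    (fun2v_hom u023 \o tens_map (bimod_id (fun2v_bimod f23)) (fun2v_hom u012)
       \o tens_assoc (fun2v_bimod f23) (fun2v_bimod f12) (fun2v_bimod f01))%VF =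
    (fun2v_hom u013
       \o tens_map (fun2v_hom u123) (bimod_id (fun2v_bimod f01)))%VF }.

(* [iota_fun alpha] is the composite of alpha with the inclusion of B^2 K^*: every
   1-cell goes to the bimodule K and u to the multiplication scaled by alpha u. *)
Section IotaCocycle.

Variables (K : fieldType) (C : bicategory) (alpha : cocycle K C).

Let KK : bimod (base_alg K) (base_alg K) := regular_bimod (base_alg K).

Section Hom.
Variable k : K.

Let b (x y : KK) : KK := k *: alg_mul x y.

Lemma iota_hom_balanced : @balanced K _ _ _ KK KK KK b.
Proof.
split=> [y c u v|x c u v|x y z]; rewrite /b.
- by rewrite (alg_mul_linearl y) scalerDr !scalerA (mulrC k).
- by rewrite (alg_mul_linearr x) scalerDr !scalerA (mulrC k).
- by rewrite /= mulrA.
Qed.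

Lemma iota_hom_L c x y : b (lact c x) y = lact c (b x y).
Proof. by rewrite /b (lin_Z (lact_linearr c)) /= mulrA. Qed.

Lemma iota_hom_R x y a : b x (ract y a) = ract (b x y) a.
Proof. by rewrite /b (lin_Z (ract_linearl a)) /= mulrA. Qed.

Definition iota_hom : bimod_hom (KK ⊗ KK) KK :=
  tens_hom iota_hom_balanced iota_hom_L iota_hom_R.

Lemma iota_homE x y : iota_hom (pure x y) = k *: alg_mul x y.
Proof. exact: tens_liftE iota_hom_balanced. Qed.

End Hom.

Lemma iota_unit_bij : bijective (bimod_id KK).
Proof. by exists id => x; rewrite id_lfunE. Qed.

Lemma iota_unitr : (iota_hom 1 \o tens_map (bimod_id KK) (bimod_id KK))%VF =
  tens_unitr KK.
Proof.
apply: tens_ext => x y; rewrite comp_lfunE tens_mapE iota_homE tens_unitrE.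
by rewrite !id_lfunE scale1r.
Qed.

Lemma iota_unitl : (iota_hom 1 \o tens_map (bimod_id KK) (bimod_id KK))%VF =
  tens_unitl KK.
Proof.
apply: tens_ext => x y; rewrite comp_lfunE tens_mapE iota_homE tens_unitlE.
by rewrite !id_lfunE scale1r.
Qed.

Lemma iota_hom3 (k k' l l' : K) : k * k' = l * l' ->
  (iota_hom k \o tens_map (bimod_id KK) (iota_hom k') \o tens_assoc KK KK KK)%VF
  = (iota_hom l \o tens_map (iota_hom l') (bimod_id KK))%VF.
Proof.
move=> kl; apply/lfunP; elim/tens_ind => [t z|s t es et]; last by rewrite !homD es et.
elim/tens_ind: t => [x y|s t es et].
  rewrite !comp_lfunE tens_assocE !tens_mapE !iota_homE !id_lfunE.
  rewrite (lin_Z (@alg_mul_linearr _ _ _)) (lin_Z (@alg_mul_linearl _ _ _)).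
  by rewrite !scalerA kl -[_ * x * y]mulrA.
by rewrite (lin_D (@pure_linearl _ _ _ _ _ _ z)) !homD es et.
Qed.

#[global] Opaque iota_hom.

Definition iota_fun : fun2vect K C :=
  @Fun2Vect K C (fun _ => base_alg K) (fun _ _ _ => KK) (fun _ => bimod_id KK)
    (fun _ _ _ _ _ _ u => iota_hom (cocycle_val alpha u))
    (fun _ => iota_unit_bij)
    (fun X Y f => etrans (congr1 (fun k : K =>
         (iota_hom k \o tens_map (bimod_id KK) (bimod_id KK))%VF)
         (cocycle_runit alpha f)) iota_unitr)
    (fun X Y f => etrans (congr1 (fun k : K =>
         (iota_hom k \o tens_map (bimod_id KK) (bimod_id KK))%VF)
         (cocycle_lunit alpha f)) iota_unitl)
    (fun _ _ _ _ _ _ _ _ _ _ _ _ _ _ s => iota_hom3 (cocycle3 alpha s)).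

End IotaCocycle.

Record category := Category {
  cat_ob :> Type;
  cat_hom : cat_ob -> cat_ob -> Type;
  cat_id : forall X, cat_hom X X;
  cat_comp : forall X Y Z, cat_hom Y Z -> cat_hom X Y -> cat_hom X Z;
  cat_id_l : forall X Y (f : cat_hom X Y), cat_comp (cat_id Y) f = f;
  cat_id_r : forall X Y (f : cat_hom X Y), cat_comp f (cat_id X) = f;
  cat_assoc : forall W X Y Z (h : cat_hom Y Z) (g : cat_hom X Y)
    (f : cat_hom W X), cat_comp h (cat_comp g f) = cat_comp (cat_comp h g) f }.
Arguments cat_id {c} X.

Record catfun (A B : category) := CatFun {
  catfun_ob :> A -> B;
  catfun_hom : forall X Y : A, cat_hom X Y -> cat_hom (catfun_ob X) (catfun_ob Y);
  catfun_id : forall X : A, catfun_hom (cat_id X) = cat_id (catfun_ob X);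
  catfun_comp : forall (X Y Z : A) (g : cat_hom Y Z) (f : cat_hom X Y),
    catfun_hom (cat_comp g f) = cat_comp (catfun_hom g) (catfun_hom f) }.

Definition id_catfun (A : category) : catfun A A :=
  @CatFun A A id (fun _ _ f => f) (fun _ => erefl) (fun _ _ _ _ _ => erefl).

Definition comp_catfun (A B D : category) (G : catfun B D) (F : catfun A B) :
    catfun A D :=
  @CatFun A D (fun X => G (F X)) (fun _ _ f => catfun_hom G (catfun_hom F f))
    (fun X => etrans (congr1 _ (catfun_id F X)) (catfun_id G (F X)))
    (fun _ _ _ g f =>
       etrans (congr1 _ (catfun_comp F g f)) (catfun_comp G _ _)).

Definition is_iso (A : category) (X Y : A) (f : cat_hom X Y) : Prop :=
  exists g : cat_hom Y X, cat_comp g f = cat_id X /\ cat_comp f g = cat_id Y.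

Definition nat_isomorphic (A B : category) (F G : catfun A B) : Prop :=
  exists eta : forall X : A, cat_hom (F X) (G X),
    (forall X, is_iso (eta X)) /\
    (forall (X Y : A) (f : cat_hom X Y),
       cat_comp (eta Y) (catfun_hom F f) = cat_comp (catfun_hom G f) (eta X)).

Definition is_equivalence (A B : category) (F : catfun A B) : Prop :=
  exists G : catfun B A,
    nat_isomorphic (comp_catfun G F) (id_catfun A) /\
    nat_isomorphic (comp_catfun F G) (id_catfun B).

Definition equivalent (A B : category) : Prop :=
  exists F : catfun A B, is_equivalence F.

(* Functors from C to Vect // B K^*; [projfun_cocycle] is the composite with the
   projection to B^2 K^*. *)
Record projfun (K : fieldType) (C : bicategory) := ProjFun {
  projfun_sp :> C -> vectType K;
  projfun_hom : forall X Y : C, cell1 X Y -> 'Hom(projfun_sp X, projfun_sp Y);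
  projfun_cocycle : cocycle K C;
  projfun_id : forall X : C, projfun_hom (id1 X) = \1%VF;
  projfun_comp : forall (X Y Z : C) (f : cell1 X Y) (g : cell1 Y Z)
    (h : cell1 X Z) (u : simplex2 f g h),
    (projfun_hom g \o projfun_hom f)%VF =
    cocycle_val projfun_cocycle u *: projfun_hom h }.

Record projrep (K : fieldType) (C : bicategory) (alpha : cocycle K C) := ProjRep {
  projrep_fun :> projfun K C;
  projrep_beta : forall X Y : C, cell1 X Y -> K;
  projrep_beta_neq0 : forall (X Y : C) (f : cell1 X Y), projrep_beta f != 0;
  projrep_betaE : forall (X Y Z : C) (f : cell1 X Y) (g : cell1 Y Z)
    (h : cell1 X Z) (u : simplex2 f g h),
    cocycle_val (projfun_cocycle projrep_fun) u * projrep_beta h =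
    cocycle_val alpha u * projrep_beta g * projrep_beta f }.

Section ProjRepCategory.

Variables (K : fieldType) (C : bicategory) (alpha : cocycle K C).

Record projrep_mor (rho rho' : projrep alpha) := ProjRepMor {
  projrep_lfun :> forall X : C, 'Hom(rho X, rho' X);
  projrep_nat : forall (X Y : C) (f : cell1 X Y),
    (projrep_lfun Y \o ((projrep_beta rho f)^-1 *: projfun_hom rho f))%VF =
    (((projrep_beta rho' f)^-1 *: projfun_hom rho' f) \o projrep_lfun X)%VF }.

Lemma projrep_mor_eq (rho rho' : projrep alpha) (h h' : projrep_mor rho rho') :
  (forall X, h X = h' X) -> h = h'.
Proof.
case: h h' => [h hn] [h' hn'] /= e.
have e' : h = h' by apply: functional_extensionality_dep.
by subst h'; congr ProjRepMor; apply: proof_irrelevance.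
Qed.

Lemma projrep_id_nat (rho : projrep alpha) (X Y : C) (f : cell1 X Y) :
  (\1 \o ((projrep_beta rho f)^-1 *: projfun_hom rho f))%VF =
  (((projrep_beta rho f)^-1 *: projfun_hom rho f) \o \1)%VF.
Proof. by rewrite comp_lfun1l comp_lfun1r. Qed.

Definition projrep_id (rho : projrep alpha) : projrep_mor rho rho :=
  @ProjRepMor rho rho (fun X => \1%VF) (@projrep_id_nat rho).

Lemma projrep_comp_nat (rho1 rho2 rho3 : projrep alpha)
    (g : projrep_mor rho2 rho3) (h : projrep_mor rho1 rho2)
    (X Y : C) (f : cell1 X Y) :
  ((g Y \o h Y) \o ((projrep_beta rho1 f)^-1 *: projfun_hom rho1 f))%VF =
  (((projrep_beta rho3 f)^-1 *: projfun_hom rho3 f) \o (g X \o h X))%VF.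
Proof. by rewrite -comp_lfunA projrep_nat comp_lfunA projrep_nat comp_lfunA. Qed.

Definition projrep_comp (rho1 rho2 rho3 : projrep alpha)
    (g : projrep_mor rho2 rho3) (h : projrep_mor rho1 rho2) :
    projrep_mor rho1 rho3 :=
  @ProjRepMor rho1 rho3 (fun X => (g X \o h X)%VF) (projrep_comp_nat g h).

Lemma projrep_id_l (rho rho' : projrep alpha) (h : projrep_mor rho rho') :
  projrep_comp (projrep_id rho') h = h.
Proof. by apply: projrep_mor_eq => X; apply: comp_lfun1l. Qed.

Lemma projrep_id_r (rho rho' : projrep alpha) (h : projrep_mor rho rho') :
  projrep_comp h (projrep_id rho) = h.
Proof. by apply: projrep_mor_eq => X; apply: comp_lfun1r. Qed.

Lemma projrep_compA (r1 r2 r3 r4 : projrep alpha) (h3 : projrep_mor r3 r4)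
    (h2 : projrep_mor r2 r3) (h1 : projrep_mor r1 r2) :
  projrep_comp h3 (projrep_comp h2 h1) = projrep_comp (projrep_comp h3 h2) h1.
Proof. by apply: projrep_mor_eq => X; apply: comp_lfunA. Qed.

Definition projrep_cat : category :=
  Category projrep_id_l projrep_id_r projrep_compA.

End ProjRepCategory.

(* Lax natural transformations from the constant functor K to J. *)
Record anomrep (K : fieldType) (C : bicategory) (J : fun2vect K C) := AnomRep {
  anomrep_mod :> forall X : C, bimod (J X) (base_alg K);
  anomrep_hom : forall (X Y : C) (f : cell1 X Y),
    bimod_hom (fun2v_bimod J f ⊗ anomrep_mod X) (anomrep_mod Y);
  anomrep_unit : forall X : C,
    (anomrep_hom (id1 X)
       \o tens_map (fun2v_unit J X) (bimod_id (anomrep_mod X)))%VF =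
    tens_unitl (anomrep_mod X);
  anomrep_comp : forall (X Y Z : C) (f : cell1 X Y) (g : cell1 Y Z)
    (h : cell1 X Z) (u : simplex2 f g h),
    (anomrep_hom g
       \o tens_map (bimod_id (fun2v_bimod J g)) (anomrep_hom f)
       \o tens_assoc (fun2v_bimod J g) (fun2v_bimod J f) (anomrep_mod X))%VF =
    (anomrep_hom h
       \o tens_map (fun2v_hom J u) (bimod_id (anomrep_mod X)))%VF }.

Section AnomRepCategory.

Variables (K : fieldType) (C : bicategory) (J : fun2vect K C).

Record anomrep_mor (Z Z' : anomrep J) := AnomRepMor {
  anomrep_bhom :> forall X : C, bimod_hom (Z X) (Z' X);
  anomrep_nat : forall (X Y : C) (f : cell1 X Y),
    (anomrep_bhom Y \o anomrep_hom Z f)%VF =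
    (anomrep_hom Z' f
       \o tens_map (bimod_id (fun2v_bimod J f)) (anomrep_bhom X))%VF }.

Lemma anomrep_mor_eq (Z Z' : anomrep J) (h h' : anomrep_mor Z Z') :
  (forall X, bimod_lfun (h X) = bimod_lfun (h' X)) -> h = h'.
Proof.
case: h h' => [h hn] [h' hn'] /= e.
have e' : h = h'.
  by apply: functional_extensionality_dep => X; apply: bimod_hom_eq.
by subst h'; congr AnomRepMor; apply: proof_irrelevance.
Qed.

Lemma anomrep_id_nat (Z : anomrep J) (X Y : C) (f : cell1 X Y) :
  (bimod_id (Z Y) \o anomrep_hom Z f)%VF =
  (anomrep_hom Z f
     \o tens_map (bimod_id (fun2v_bimod J f)) (bimod_id (Z X)))%VF.
Proof.
by apply: tens_ext => m z; rewrite !comp_lfunE tens_mapE !id_lfunE.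
Qed.

Definition anomrep_id (Z : anomrep J) : anomrep_mor Z Z :=
  @AnomRepMor Z Z (fun X => bimod_id (Z X)) (@anomrep_id_nat Z).

Lemma anomrep_comp_nat (Z1 Z2 Z3 : anomrep J)
    (g : anomrep_mor Z2 Z3) (h : anomrep_mor Z1 Z2) (X Y : C) (f : cell1 X Y) :
  (bimod_comp (g Y) (h Y) \o anomrep_hom Z1 f)%VF =
  (anomrep_hom Z3 f
     \o tens_map (bimod_id (fun2v_bimod J f)) (bimod_comp (g X) (h X)))%VF.
Proof.
rewrite /= -comp_lfunA anomrep_nat comp_lfunA anomrep_nat -comp_lfunA.
congr (_ \o _)%VF; apply: tens_ext => m z.
by rewrite !comp_lfunE !tens_mapE !id_lfunE /= comp_lfunE.
Qed.

Definition anomrep_mor_comp (Z1 Z2 Z3 : anomrep J)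
    (g : anomrep_mor Z2 Z3) (h : anomrep_mor Z1 Z2) : anomrep_mor Z1 Z3 :=
  @AnomRepMor Z1 Z3 (fun X => bimod_comp (g X) (h X)) (anomrep_comp_nat g h).

Lemma anomrep_id_l (Z Z' : anomrep J) (h : anomrep_mor Z Z') :
  anomrep_mor_comp (anomrep_id Z') h = h.
Proof. by apply: anomrep_mor_eq => X; apply: comp_lfun1l. Qed.

Lemma anomrep_id_r (Z Z' : anomrep J) (h : anomrep_mor Z Z') :
  anomrep_mor_comp h (anomrep_id Z) = h.
Proof. by apply: anomrep_mor_eq => X; apply: comp_lfun1r. Qed.

Lemma anomrep_compA (Z1 Z2 Z3 Z4 : anomrep J) (h3 : anomrep_mor Z3 Z4)
    (h2 : anomrep_mor Z2 Z3) (h1 : anomrep_mor Z1 Z2) :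
  anomrep_mor_comp h3 (anomrep_mor_comp h2 h1) =
  anomrep_mor_comp (anomrep_mor_comp h3 h2) h1.
Proof. by apply: anomrep_mor_eq => X; apply: comp_lfunA. Qed.

Definition anomrep_cat : category :=
  Category anomrep_id_l anomrep_id_r anomrep_compA.

End AnomRepCategory.

(* Lax natural transformations from J to iota o alpha. *)
Record alpha_structure (K : fieldType) (C : bicategory) (alpha : cocycle K C)
    (J : fun2vect K C) := AlphaStructure {
  astr_mod :> forall X : C, bimod (base_alg K) (J X);
  astr_hom : forall (X Y : C) (f : cell1 X Y),
    bimod_hom (astr_mod X) (astr_mod Y ⊗ fun2v_bimod J f);
  astr_unit : forall (X : C) (x : astr_mod X),
    astr_hom (id1 X) x = pure x (fun2v_unit J X alg_one);
  astr_comp : forall (X Y Z : C) (f : cell1 X Y) (g : cell1 Y Z)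
    (h : cell1 X Z) (u : simplex2 f g h),
    cocycle_val alpha u *: bimod_lfun (astr_hom h) =
    (tens_map (bimod_id (astr_mod Z)) (fun2v_hom J u)
       \o tens_assoc (astr_mod Z) (fun2v_bimod J g) (fun2v_bimod J f)
       \o tens_map (astr_hom g) (bimod_id (fun2v_bimod J f))
       \o astr_hom f)%VF }.

Definition invertible_bimod (K : fieldType) (B A : fdalg K) (M : bimod B A) :
    Prop :=
  exists N : bimod A B, bimod_isom (M ⊗ N) (regular_bimod B) /\
    bimod_isom (N ⊗ M) (regular_bimod A).

Definition invertible_astr (K : fieldType) (C : bicategory)
    (alpha : cocycle K C) (J : fun2vect K C) (xi : alpha_structure alpha J) :
    Prop :=
  (forall X : C, invertible_bimod (xi X)) /\
  (forall (X Y : C) (f : cell1 X Y), bijective (astr_hom xi f)).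

(* The functor Z |-> rho_(xi o Z). *)
Section Induced.

Variables (K : fieldType) (C : bicategory) (alpha : cocycle K C).
Variables (J : fun2vect K C) (xi : alpha_structure alpha J).

Section Object.
Variable Z : anomrep J.

Definition induced_hom (X Y : C) (f : cell1 X Y) : 'Hom(xi X ⊗ Z X, xi Y ⊗ Z Y) :=
  (tens_map (bimod_id (xi Y)) (anomrep_hom Z f)
     \o tens_assoc (xi Y) (fun2v_bimod J f) (Z X)
     \o tens_map (astr_hom xi f) (bimod_id (Z X)))%VF.

Let phi (X Y : C) (f : cell1 X Y) (z : Z X) (t : xi Y ⊗ fun2v_bimod J f) :
    xi Y ⊗ Z Y :=
  tens_map (bimod_id (xi Y)) (anomrep_hom Z f)
    (tens_assoc (xi Y) (fun2v_bimod J f) (Z X) (pure t z)).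

Let phiD (X Y : C) (f : cell1 X Y) z : linear (@phi X Y f z).
Proof. by move=> k s t; rewrite /phi pure_linearl !linearP. Qed.

Let phiE (X Y : C) (f : cell1 X Y) z y m :
  @phi X Y f z (pure y m) = pure y (anomrep_hom Z f (pure m z)).
Proof. by rewrite /phi tens_assocE tens_mapE id_lfunE. Qed.

Lemma induced_homE (X Y : C) (f : cell1 X Y) x z :
  induced_hom f (pure x z) = phi z (astr_hom xi f x).
Proof. by rewrite /induced_hom !comp_lfunE tens_mapE id_lfunE. Qed.

Lemma induced_hom_id (X : C) : induced_hom (id1 X) = \1%VF.
Proof.
apply: tens_ext => x z; rewrite induced_homE astr_unit phiE id_lfunE.
have := hom_app (anomrep_unit Z X) (pure (alg_one : regular_bimod (J X)) z).
by rewrite comp_lfunE tens_mapE tens_unitlE id_lfunE lact1 => ->.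
Qed.

Lemma induced_hom_comp (X Y W : C) (f : cell1 X Y) (g : cell1 Y W)
    (h : cell1 X W) (u : simplex2 f g h) :
  (induced_hom g \o induced_hom f)%VF = cocycle_val alpha u *: induced_hom h.
Proof.
apply: tens_ext => x z; rewrite comp_lfunE scale_lfunE !induced_homE.
have := hom_app (astr_comp xi u) x.
rewrite scale_lfunE !comp_lfunE -(lin_Z (@phiD _ _ h z)) => ->.
elim/tens_ind: (astr_hom xi f x) => [y m|s t es et]; last first.
  by rewrite (lin_D (@phiD _ _ f z)) !homD (lin_D (@phiD _ _ h z)) es et.
rewrite phiE !tens_mapE !id_lfunE -/(phi _ _).
elim/tens_ind: (astr_hom xi g y) => [w n|s t es et]; last first.
  rewrite (lin_D (@phiD _ _ g _)) (lin_D (@pure_linearl _ _ _ _ _ _ m)).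
  by rewrite !homD (lin_D (@phiD _ _ h z)) es et.
rewrite phiE tens_assocE tens_mapE phiE id_lfunE.
have := hom_app (anomrep_comp Z u) (pure (pure n m) z).
by rewrite !comp_lfunE tens_assocE !tens_mapE !id_lfunE => ->.
Qed.

Definition induced_projfun : projfun K C :=
  @ProjFun K C (fun X => xi X ⊗ Z X) induced_hom alpha
    induced_hom_id induced_hom_comp.

Lemma induced_betaE (X Y W : C) (f : cell1 X Y) (g : cell1 Y W)
    (h : cell1 X W) (u : simplex2 f g h) :
  cocycle_val (projfun_cocycle induced_projfun) u * 1 = cocycle_val alpha u * 1 * 1.
Proof. by rewrite !mulr1. Qed.

Definition induced_projrep : projrep alpha :=
  @ProjRep K C alpha induced_projfun (fun _ _ _ => 1)
    (fun _ _ _ => oner_neq0 K) induced_betaE.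

End Object.

Section Morphism.
Variables (Z Z' : anomrep J) (h : anomrep_mor Z Z').

Definition induced_mor_hom (X : C) :
    'Hom(induced_projrep Z X, induced_projrep Z' X) :=
  tens_map (bimod_id (xi X)) (h X).

Lemma induced_mor_nat (X Y : C) (f : cell1 X Y) :
  (induced_mor_hom Y \o (1^-1 *: induced_hom Z f))%VF =
  ((1^-1 *: induced_hom Z' f) \o induced_mor_hom X)%VF.
Proof.
rewrite invr1 !scale1r; apply: tens_ext => x z.
rewrite !comp_lfunE !tens_mapE !id_lfunE.
elim/tens_ind: (astr_hom xi f x) => [y m|s t es et].
  rewrite !tens_assocE !tens_mapE !id_lfunE.
  have := hom_app (anomrep_nat h f) (pure m z).
  by rewrite !comp_lfunE tens_mapE id_lfunE => ->.
rewrite (lin_D (@pure_linearl _ _ _ _ _ _ z)).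
by rewrite (lin_D (@pure_linearl _ _ _ _ _ _ (h X z))) !homD es et.
Qed.

Definition induced_mor : projrep_mor (induced_projrep Z) (induced_projrep Z') :=
  @ProjRepMor K C alpha (induced_projrep Z) (induced_projrep Z')
    induced_mor_hom induced_mor_nat.

End Morphism.

Lemma induced_id (Z : anomrep J) :
  induced_mor (anomrep_id Z) = projrep_id (induced_projrep Z).
Proof.
apply: projrep_mor_eq => X; apply: tens_ext => x z.
by rewrite tens_mapE !id_lfunE.
Qed.

Lemma induced_comp (Z1 Z2 Z3 : anomrep J)
    (g : anomrep_mor Z2 Z3) (h : anomrep_mor Z1 Z2) :
  induced_mor (anomrep_mor_comp g h) = projrep_comp (induced_mor g) (induced_mor h).
Proof.
apply: projrep_mor_eq => X; apply: tens_ext => x z.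
by rewrite comp_lfunE !tens_mapE !id_lfunE comp_lfunE.
Qed.

Definition induced : catfun (anomrep_cat J) (projrep_cat alpha) :=
  @CatFun (anomrep_cat J) (projrep_cat alpha)
    induced_projrep induced_mor induced_id induced_comp.

End Induced.

(* Main.v *)
(* The functor M ⊗ - for an invertible bimodule M is fully faithful.  Since every
   xi f is invertible, a |-> (id ⊗ a) o (xi f ⊗ id) identifies the module maps
   J f ⊗ P -> Q with the linear maps xi X ⊗ P -> xi Y ⊗ Q, compatibly with
   composition up to the scalars alpha.  Full faithfulness of the induced functor
   follows; for essential surjectivity, put Z X = N X ⊗ rho X with N X an inverse of
   xi X, and let Z f correspond to beta(f)^-1 rho f.  For J = iota o alpha the maps
   x |-> x ⊗ 1 form an invertible alpha-structure. *)
Require Import Defs.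
From mathcomp Require Import all_boot all_order all_algebra.
From mathcomp Require Import ring.
From Stdlib Require Import IndefiniteDescription.

Set Implicit Arguments.
Unset Strict Implicit.
Unset Printing Implicit Defensive.

Import GRing.Theory.
Local Open Scope ring_scope.

(** * Choice, and equivalences of categories from fully faithful, essentially surjective functors *)

Lemma dependent_choice (A : Type) (T : A -> Type) (P : forall a, T a -> Prop) :
  (forall a, exists x : T a, P a x) ->
  exists f : forall a, T a, forall a, P a (f a).
Proof.
(* A quasi-inverse functor is data, whereas fullness and essential surjectivity only assert
   existence in [Prop]; this axiom bridges the two. *)
move=> ex; exists (fun a => sval (constructive_indefinite_description _ (ex a))).
by move=> a; exact: svalP (constructive_indefinite_description _ (ex a)).
Qed.

(** The quasi-inverse sends [Y] to a chosen object [G0 Y] with an isomorphism [e Y : F (G0 Y) -> Y],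
    and [f] to the lift of its conjugate by [e]. Every equation between lifts follows from
    faithfulness, by comparing images under [F]. *)
Lemma is_equivalence_ff_es (A B : category) (F : catfun A B) :
    (forall (X Y : A) (f g : cat_hom X Y),
       catfun_hom F f = catfun_hom F g -> f = g) ->
    (forall (X Y : A) (g : cat_hom (F X) (F Y)),
       exists f : cat_hom X Y, catfun_hom F f = g) ->
    (forall Y : B, exists (X : A) (f : cat_hom (F X) Y), is_iso f) ->
  is_equivalence F.
Proof.
move=> inj full es.
(* Pairing each isomorphism with its inverse lets one choice deliver both. *)
have data (Y : B) : exists (X : A) (d : cat_hom (F X) Y * cat_hom Y (F X)),
    cat_comp d.2 d.1 = cat_id (F X) /\ cat_comp d.1 d.2 = cat_id Y.
  by have [X [f [g gf]]] := es Y; exists X, (f, g).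
have [G0 {}data] := dependent_choice data; have [d dK] := dependent_choice data.
pose e Y := (d Y).1; pose e' Y := (d Y).2.
have e'e Y : cat_comp (e' Y) (e Y) = cat_id _ := (dK Y).1.
have ee' Y : cat_comp (e Y) (e' Y) = cat_id _ := (dK Y).2.
have [lift liftE] := dependent_choice (fun X => dependent_choice (fun Y =>
  dependent_choice (full X Y))).
pose G1 (Y Y' : B) (f : cat_hom Y Y') : cat_hom (G0 Y) (G0 Y') :=
  lift _ _ (cat_comp (e' Y') (cat_comp f (e Y))).
have G1_id Y : G1 _ _ (cat_id Y) = cat_id (G0 Y).
  by apply: inj; rewrite liftE catfun_id cat_id_l e'e.
have G1_comp (Y1 Y2 Y3 : B) (g : cat_hom Y2 Y3) (f : cat_hom Y1 Y2) :
    G1 _ _ (cat_comp g f) = cat_comp (G1 _ _ g) (G1 _ _ f).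
  apply: inj; rewrite catfun_comp !liftE -!cat_assoc; congr cat_comp.
  by congr cat_comp; rewrite !cat_assoc ee' cat_id_l.
exists (CatFun G1_id G1_comp); split.
- exists (fun X => lift _ _ (e (F X))); split=> [X|X Y f] /=.
  + exists (lift _ _ (e' (F X))).
    by split; apply: inj; rewrite catfun_comp !liftE catfun_id.
  + apply: inj; rewrite !catfun_comp !liftE.
    by rewrite cat_assoc ee' cat_id_l.
- exists e; split=> [Y|Y Y' f] /=; first by exists (e' Y).
  by rewrite liftE cat_assoc ee' cat_id_l.
Qed.

(** The reversal of direction is deliberate: [induced] starts from anomalous representations, while
    [equivalent] is wanted starting from projective ones. *)
Lemma is_equivalence_equivalent (A B : category) (F : catfun A B) :
  is_equivalence F -> equivalent B A.
Proof. by case=> G [GF FG]; exists G, F. Qed.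

(** * Isomorphisms of bimodules, and tensoring with an invertible bimodule *)

Section Bimodules.

Variable K : fieldType.

Lemma lfun_comp_bij (U V W : vectType K) (g : 'Hom(V, W)) (f : 'Hom(U, V)) :
  bijective g -> bijective f -> bijective (g \o f)%VF.
Proof.
move=> gb fb; apply: (eq_bij (bij_comp gb fb)) => x.
by rewrite comp_lfunE.
Qed.

Lemma bimod_hom_inv (B A : fdalg K) (M N : bimod B A) (f : bimod_hom M N) :
  bijective f -> exists g : bimod_hom N M, cancel f g /\ cancel g f.
Proof.
case=> g fK gK.
have glin : linear g by move=> k x y; rewrite -{1}[x]gK -{1}[y]gK -linearP fK.
have gE : linfun g =1 g by exact: linfun_linear.
have gL b n : linfun g (lact b n) = lact b (linfun g n).
  by rewrite !gE -{1}[n]gK -bimod_homL fK.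
have gR n a : linfun g (ract n a) = ract (linfun g n) a.
  by rewrite !gE -{1}[n]gK -bimod_homR fK.
by exists (BimodHom gL gR); split=> x /=; rewrite gE.
Qed.

Lemma tens_map_bij (C B A : fdalg K) (M M' : bimod C B) (N N' : bimod B A)
    (f : bimod_hom M M') (g : bimod_hom N N') :
  bijective f -> bijective g -> bijective (tens_map f g).
Proof.
move=> /bimod_hom_inv[f' [fK f'K]] /bimod_hom_inv[g' [gK g'K]].
exists (tens_map f' g'); elim/tens_ind => [m n|s t es et];
  by rewrite ?homD ?es ?et // !tens_mapE ?fK ?gK ?f'K ?g'K.
Qed.

Lemma bimod_id_bij (B A : fdalg K) (M : bimod B A) : bijective (bimod_id M).
Proof. by exists id => x; rewrite id_lfunE. Qed.

Lemma tens_unitl_bij (B A : fdalg K) (M : bimod B A) : bijective (tens_unitl M).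
Proof.
exists (pure (alg_one : regular_bimod B)) => [t|m]; last by rewrite tens_unitlE lact1.
elim/tens_ind: t => [b m|s t es et].
  by rewrite tens_unitlE -pure_bal /= alg_mul1l.
by rewrite homD (lin_D (@pure_linearr _ _ _ _ _ _ _)) es et.
Qed.

Section UnitrInverse.
Variables (B A : fdalg K) (M : bimod B A).

Let f (m : M) : M ⊗ regular_bimod A := pure m (alg_one : regular_bimod A).

Let f_lin : linear f.
Proof. exact: pure_linearl. Qed.

Let fL b m : linfun f (lact b m) = lact b (linfun f m).
Proof. by rewrite !linfun_linear // /f lact_pure. Qed.

Let fR m a : linfun f (ract m a) = ract (linfun f m) a.
Proof.
by rewrite !linfun_linear // /f ract_pure pure_bal /= alg_mul1l alg_mul1r.
Qed.

(** The inverse of [tens_unitr], kept explicit because it supplies the structure maps of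
    [iota_astr]. *)
Definition tens_unitrV : bimod_hom M (M ⊗ regular_bimod A) := BimodHom fL fR.

Lemma tens_unitrVE m : tens_unitrV m = pure m (alg_one : regular_bimod A).
Proof. exact: linfun_linear f_lin m. Qed.

Lemma tens_unitrV_bij : bijective tens_unitrV.
Proof.
exists (tens_unitr M) => [m|t]; first by rewrite tens_unitrVE tens_unitrE ract1.
elim/tens_ind: t => [m a|s t es et]; last by rewrite !homD es et.
by rewrite tens_unitrE tens_unitrVE pure_bal /= alg_mul1r.
Qed.

End UnitrInverse.

Section Assoc.
Variables (D C B A : fdalg K) (M : bimod D C) (N : bimod C B) (P : bimod B A).

Let b0 (m : M) (n : N) (p : P) : M ⊗ N ⊗ P := pure (pure m n) p.

Let b0_bal m : balanced (b0 m).
Proof.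
split=> [p k x y|n|n x p]; rewrite /b0.
- by rewrite pure_linearr pure_linearl.
- exact: pure_linearr.
- by rewrite -ract_pure pure_bal.
Qed.

Let b (m : M) (t : N ⊗ P) : M ⊗ N ⊗ P := tens_lift (b0 m) t.

Let bE m n p : b m (pure n p) = pure (pure m n) p.
Proof. exact: tens_liftE (b0_bal m). Qed.

Let bD m s t : b m (s + t) = b m s + b m t.
Proof. exact: homD. Qed.

Let b_bal : balanced b.
Proof.
split=> [t k x y|m|m x t]; last 2 first.
- exact: hom_linear.
- elim/tens_ind: t => [n p|s t es et].
    by rewrite lact_pure !bE pure_bal.
  by rewrite (lin_D (lact_linearr x)) !bD es et.
elim/tens_ind: t => [n p|s t es et]; first by rewrite !bE !pure_linearl.
by rewrite !bD es et scalerDr addrACA.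
Qed.

(** The inverse is lifted in two stages: [b0 m] is balanced in [n] and [p] for fixed [m], and the
    resulting [b] is balanced in [m] and the tensor. *)
Lemma tens_assoc_bij : bijective (tens_assoc M N P).
Proof.
exists (tens_lift b : 'Hom(M ⊗ (N ⊗ P), M ⊗ N ⊗ P)); elim/tens_ind.
- move=> t p; elim/tens_ind: t => [m n|s t es et].
    by rewrite tens_assocE tens_liftE ?bE.
  by rewrite (lin_D (@pure_linearl _ _ _ _ _ _ p)) !homD es et.
- by move=> s t es et; rewrite !homD es et.
- move=> m t; rewrite tens_liftE //; elim/tens_ind: t => [n p|s t es et].
    by rewrite bE tens_assocE.
  by rewrite (lin_D (@pure_linearr _ _ _ _ _ _ m)) bD homD es et.
- by move=> s t es et; rewrite !homD es et.
Qed.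

End Assoc.

(** Reassociate, contract [N ⊗ M] to [A] by [e], then absorb [A] into [P]. *)
Lemma tens_contract (B A D : fdalg K) (M : bimod B A) (N : bimod A B)
    (e : bimod_hom (N ⊗ M) (regular_bimod A)) (P : bimod A D) :
  bijective e ->
  exists c : bimod_hom (N ⊗ (M ⊗ P)) P, bijective c /\
    forall n m p, c (pure n (pure m p)) = lact (e (pure n m)) p.
Proof.
move=> ebij.
have [a [aK a'K]] := bimod_hom_inv (tens_assoc_bij N M P).
exists (bimod_comp (tens_unitl P) (bimod_comp (tens_map e (bimod_id P)) a)).
split=> [|n m p].
  apply: lfun_comp_bij (tens_unitl_bij P) _.
  apply: lfun_comp_bij; last by exists (tens_assoc N M P).
  exact: tens_map_bij (bimod_id_bij P).
by rewrite !comp_lfunE -(tens_assocE n m p) aK tens_mapE tens_unitlE id_lfunE.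
Qed.

(** On pure tensors, contraction is the action of the scalar [e (pure n m)], with which the module
    map [f] commutes. *)
Lemma tens_contract_nat (B A D : fdalg K) (M : bimod B A) (N : bimod A B)
    (e : N ⊗ M -> A) (P Q : bimod A D)
    (c : bimod_hom (N ⊗ (M ⊗ P)) P) (d : bimod_hom (N ⊗ (M ⊗ Q)) Q) :
    (forall n m p, c (pure n (pure m p)) = lact (e (pure n m)) p) ->
    (forall n m p, d (pure n (pure m p)) = lact (e (pure n m)) p) ->
  forall (f : bimod_hom P Q) t,
    d (tens_map (bimod_id N) (tens_map (bimod_id M) f) t) = f (c t).
Proof.
move=> cE dE f; elim/tens_ind => [n t|s t es et]; last by rewrite !homD es et.
rewrite tens_mapE id_lfunE; elim/tens_ind: t => [m p|s t es et].
  by rewrite tens_mapE id_lfunE cE dE bimod_homL.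
by rewrite homD !(lin_D (@pure_linearr _ _ _ _ _ _ n)) !homD es et.
Qed.

(** By naturality of the contraction, [f] is recovered from [N ⊗ (M ⊗ f)]. *)
Lemma tens_faithful (B A D : fdalg K) (M : bimod B A) (P Q : bimod A D)
    (f g : bimod_hom P Q) : invertible_bimod M ->
  bimod_lfun (tens_map (bimod_id M) f) = tens_map (bimod_id M) g ->
  bimod_lfun f = g.
Proof.
case=> N [_ [e ebij]] fg.
have [c [[c' cK c'K] cE]] := tens_contract P ebij.
have [d [_ dE]] := tens_contract Q ebij.
apply/lfunP => p; rewrite -[p]c'K -!(tens_contract_nat cE dE).
by rewrite (bimod_hom_eq fg).
Qed.

(* The functor N ⊗ (M ⊗ -) is full, being isomorphic to the identity, and
   N ⊗ - is faithful; hence M ⊗ - is full.  This avoids adjusting the two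
   isomorphisms N ⊗ M ≅ A and M ⊗ N ≅ B to satisfy the triangle identities. *)
Lemma tens_full (B A D : fdalg K) (M : bimod B A) (P Q : bimod A D)
    (g : bimod_hom (M ⊗ P) (M ⊗ Q)) : invertible_bimod M ->
  exists f : bimod_hom P Q, bimod_lfun (tens_map (bimod_id M) f) = g.
Proof.
case=> N [MN NM]; have Ninv : invertible_bimod N by exists M.
case: NM => e ebij.
have [c [cb cE]] := tens_contract P ebij.
have [d [[d' dK _] dE]] := tens_contract Q ebij.
have [c' [cK _]] := bimod_hom_inv cb.
exists (bimod_comp d (bimod_comp (tens_map (bimod_id N) g) c')).
apply: (tens_faithful Ninv); apply/lfunP => t.
apply: (can_inj dK); rewrite (tens_contract_nat cE dE).
by rewrite !comp_lfunE cK.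
Qed.

Lemma base_lact (A : fdalg K) (M : bimod (base_alg K) A) (k : base_alg K) (m : M) :
  lact k m = (k : K) *: m.
Proof.
have -> : lact k m = lact ((k : K) *: (alg_one : base_alg K)) m.
  by congr (lact _ m); apply: esym (mulr1 _).
by rewrite (lin_Z (lact_linearl m)) lact1.
Qed.

Lemma base_ract (A : fdalg K) (M : bimod A (base_alg K)) (m : M) (k : base_alg K) :
  ract m k = (k : K) *: m.
Proof.
have -> : ract m k = ract m ((k : K) *: (alg_one : base_alg K)).
  by congr (ract m _); apply: esym (mulr1 _).
by rewrite (lin_Z (ract_linearr m)) ract1.
Qed.

(** Both actions of [K] are scalar multiplication. Hence the plain linear maps in projective
    representations and their morphisms can be fed to [tens_full]. *)
Lemma base_bimod_hom (M N : bimod (base_alg K) (base_alg K)) (f : 'Hom(M, N)) :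
  exists g : bimod_hom M N, bimod_lfun g = f.
Proof.
have fL b m : f (lact b m) = lact b (f m) by rewrite !base_lact linearZ.
have fR m a : f (ract m a) = ract (f m) a by rewrite !base_ract linearZ.
by exists (BimodHom fL fR).
Qed.

Section VectBimod.
Variable V : vectType K.

Let act (k : base_alg K) (v : V) : V := (k : K) *: v.

Let act_linearl v : linear (act ^~ v).
Proof. by move=> k x y; rewrite /act scalerDl scalerA. Qed.

Let act_linearr k : linear (act k).
Proof. by move=> l x y; rewrite /act scalerDr !scalerA mulrC. Qed.

Let act1 v : act alg_one v = v.
Proof. exact: scale1r. Qed.

Let actM k l v : act (alg_mul k l) v = act k (act l v).
Proof. by rewrite /act scalerA. Qed.

Let actC v k l : act (alg_mul k l) v = act l (act k v).
Proof. by rewrite -actM /= mulrC. Qed.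

Let actA k v l : act l (act k v) = act k (act l v).
Proof. by rewrite -actC actM. Qed.

Definition vect_bimod : bimod (base_alg K) (base_alg K) :=
  @Bimod K (base_alg K) (base_alg K) V act (fun v k => act k v)
    act_linearl act_linearr act_linearr act_linearl act1 actM act1 actC actA.

End VectBimod.

End Bimodules.

(** * Transport of actions along an invertible [alpha]-structure *)

Section Transport.

Variables (K : fieldType) (C : bicategory) (alpha : cocycle K C).
Variables (J : fun2vect K C) (xi : alpha_structure alpha J).
Hypothesis xi_inv : invertible_astr xi.

(* [transport a] is the value of [induced_hom] when [a] is the action of f on an
   anomalous representation. *)
Definition transport (X Y : C) (f : cell1 X Y) (P : bimod (J X) (base_alg K))
    (Q : bimod (J Y) (base_alg K)) (a : bimod_hom (fun2v_bimod J f ⊗ P) Q) :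
    bimod_hom (xi X ⊗ P) (xi Y ⊗ Q) :=
  bimod_comp
    (bimod_comp (tens_map (bimod_id (xi Y)) a)
       (tens_assoc (xi Y) (fun2v_bimod J f) P))
    (tens_map (astr_hom xi f) (bimod_id P)).

Lemma transportE (X Y : C) (f : cell1 X Y) (P : bimod (J X) (base_alg K))
    (Q : bimod (J Y) (base_alg K)) (a : bimod_hom (fun2v_bimod J f ⊗ P) Q) x p :
  transport a (pure x p) =
  tens_map (bimod_id (xi Y)) a
    (tens_assoc (xi Y) (fun2v_bimod J f) P (pure (astr_hom xi f x) p)).
Proof. by rewrite !comp_lfunE tens_mapE id_lfunE. Qed.

(** This isomorphism of [xi X ⊗ P] with [xi Y ⊗ (J f ⊗ P)] is the factor of [transport a] that does
    not depend on [a]; cancelling it reduces injectivity and surjectivity of [transport] to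
    [tens_faithful] and [tens_full]. *)
Lemma tens_assoc_astr_bij (X Y : C) (f : cell1 X Y) (P : bimod (J X) (base_alg K)) :
  bijective (tens_assoc (xi Y) (fun2v_bimod J f) P
               \o tens_map (astr_hom xi f) (bimod_id P))%VF.
Proof.
apply: lfun_comp_bij (tens_assoc_bij _ _ _) _.
exact: tens_map_bij (xi_inv.2 _ _ f) (bimod_id_bij P).
Qed.

Lemma transport_inj (X Y : C) (f : cell1 X Y) (P : bimod (J X) (base_alg K))
    (Q : bimod (J Y) (base_alg K)) (a b : bimod_hom (fun2v_bimod J f ⊗ P) Q) :
  bimod_lfun (transport a) = transport b -> bimod_lfun a = b.
Proof.
move=> ab; apply: (tens_faithful (xi_inv.1 Y)).
have [g _ gK] := tens_assoc_astr_bij f P.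
apply/lfunP => t; rewrite -[t]gK -!comp_lfunE !comp_lfunA.
exact: hom_app ab _.
Qed.

Lemma transport_surj (X Y : C) (f : cell1 X Y) (P : bimod (J X) (base_alg K))
    (Q : bimod (J Y) (base_alg K)) (g : 'Hom(xi X ⊗ P, xi Y ⊗ Q)) :
  exists a : bimod_hom (fun2v_bimod J f ⊗ P) Q, bimod_lfun (transport a) = g.
Proof.
have [t [tK _]] := @bimod_hom_inv _ _ _ _ _
  (bimod_comp (tens_assoc (xi Y) (fun2v_bimod J f) P)
     (tens_map (astr_hom xi f) (bimod_id P))) (tens_assoc_astr_bij f P).
have [g' g'E] := base_bimod_hom g.
have [a aE] := tens_full (bimod_comp g' t) (xi_inv.1 Y).
exists a; apply/lfunP => x; have := hom_app aE.
move/(_ ((tens_assoc (xi Y) (fun2v_bimod J f) P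
            \o tens_map (astr_hom xi f) (bimod_id P))%VF x)).
by rewrite [RHS]comp_lfunE [t _]tK g'E !comp_lfunE.
Qed.

Lemma transport_natl (X Y : C) (f : cell1 X Y) (P : bimod (J X) (base_alg K))
    (Q Q' : bimod (J Y) (base_alg K)) (h : bimod_hom Q Q')
    (a : bimod_hom (fun2v_bimod J f ⊗ P) Q) :
  bimod_lfun (transport (bimod_comp h a)) =
  (tens_map (bimod_id (xi Y)) h \o transport a)%VF.
Proof.
apply: tens_ext => x p; rewrite comp_lfunE !transportE.
elim/tens_ind: (astr_hom xi f x) => [y m|s t es et].
  by rewrite tens_assocE !tens_mapE !id_lfunE comp_lfunE.
by rewrite (lin_D (@pure_linearl _ _ _ _ _ _ p)) !homD es et.
Qed.

Lemma transport_natr (X Y : C) (f : cell1 X Y) (P P' : bimod (J X) (base_alg K))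
    (Q : bimod (J Y) (base_alg K)) (h : bimod_hom P' P)
    (a : bimod_hom (fun2v_bimod J f ⊗ P) Q) :
  bimod_lfun (transport
    (bimod_comp a (tens_map (bimod_id (fun2v_bimod J f)) h))) =
  (transport a \o tens_map (bimod_id (xi X)) h)%VF.
Proof.
apply: tens_ext => x p; rewrite comp_lfunE tens_mapE id_lfunE !transportE.
elim/tens_ind: (astr_hom xi f x) => [y m|s t es et].
  by rewrite !tens_assocE !tens_mapE !id_lfunE comp_lfunE tens_mapE id_lfunE.
by rewrite !(lin_D (@pure_linearl _ _ _ _ _ _ _)) !homD es et.
Qed.

(** By [astr_unit], [transport a] sends [x ⊗ p] to [x ⊗ a (1 ⊗ p)], with 1 embedded by [fun2v_unit];
    the hypothesis then gives the unit law after tensoring with [xi X], which is faithful. *)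
Lemma transport_unit (X : C) (P : bimod (J X) (base_alg K))
    (a : bimod_hom (fun2v_bimod J (id1 X) ⊗ P) P) :
  bimod_lfun (transport a) = \1%VF ->
  (a \o tens_map (fun2v_unit J X) (bimod_id P))%VF = tens_unitl P.
Proof.
move=> a1; apply: (@tens_faithful _ _ _ _ _ _ _
  (bimod_comp a (tens_map (fun2v_unit J X) (bimod_id P))) _ (xi_inv.1 X)).
apply/lfunP; elim/tens_ind => [x t|s t es et]; last by rewrite !homD es et.
elim/tens_ind: t => [b p|s t es et]; last first.
  by rewrite (lin_D (@pure_linearr _ _ _ _ _ _ _)) !homD es et.
rewrite !tens_mapE !id_lfunE comp_lfunE tens_mapE id_lfunE tens_unitlE.
(* [astr_unit] only involves the unit element, so [b] is written as [b] times 1 and moved across the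
   tensor sign onto [x]. *)
have -> : b = lact b (alg_one : regular_bimod (J X)) by rewrite /= alg_mul1r.
rewrite bimod_homL -lact_pure bimod_homL -!pure_bal /= alg_mul1r.
have := hom_app a1 (pure (ract x b) p).
by rewrite transportE astr_unit tens_assocE tens_mapE !id_lfunE.
Qed.

Section Composition.

Variables (X Y W : C) (f : cell1 X Y) (g : cell1 Y W) (h : cell1 X W).
Variable u : simplex2 f g h.
Variables (P : bimod (J X) (base_alg K)) (Q : bimod (J Y) (base_alg K)).
Variable R : bimod (J W) (base_alg K).
Variables (a : bimod_hom (fun2v_bimod J f ⊗ P) Q).
Variables (b : bimod_hom (fun2v_bimod J g ⊗ Q) R).
Variables (c : bimod_hom (fun2v_bimod J h ⊗ P) R).

(** The structure maps of [xi] along [f] and then [g]. By [astr_comp], following [s0] with [J u]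
    gives the structure map along [h] scaled by [alpha u]. *)
Let s0 : 'Hom(xi X, xi W ⊗ (fun2v_bimod J g ⊗ fun2v_bimod J f)) :=
  (tens_assoc (xi W) (fun2v_bimod J g) (fun2v_bimod J f)
     \o tens_map (astr_hom xi g) (bimod_id (fun2v_bimod J f))
     \o astr_hom xi f)%VF.

Let shuffle (t : xi W ⊗ (fun2v_bimod J g ⊗ fun2v_bimod J f)) (p : P) :
    xi W ⊗ (fun2v_bimod J g ⊗ fun2v_bimod J f ⊗ P) :=
  tens_assoc _ _ _ (pure t p).

Let shuffleD s t p : shuffle (s + t) p = shuffle s p + shuffle t p.
Proof. by rewrite /shuffle (lin_D (@pure_linearl _ _ _ _ _ _ p)) homD. Qed.

Lemma transport_comp_l x p :
  transport b (transport a (pure x p)) =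
  tens_map (bimod_id (xi W))
    (bimod_comp b (bimod_comp (tens_map (bimod_id (fun2v_bimod J g)) a)
       (tens_assoc (fun2v_bimod J g) (fun2v_bimod J f) P)))
    (shuffle (s0 x) p).
Proof.
rewrite transportE /s0 !comp_lfunE.
elim/tens_ind: (astr_hom xi f x) => [y m|s t es et]; last first.
  by rewrite (lin_D (@pure_linearl _ _ _ _ _ _ p)) !homD shuffleD homD es et.
rewrite tens_assocE !tens_mapE !id_lfunE.
elim/tens_ind: (astr_hom xi g y) => [w n|s t es et]; last first.
  by rewrite !(lin_D (@pure_linearl _ _ _ _ _ _ _)) !homD shuffleD homD es et.
rewrite /shuffle !tens_assocE !tens_mapE !id_lfunE !comp_lfunE.
by rewrite tens_assocE tens_mapE id_lfunE.
Qed.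

Lemma transport_comp_r x p :
  cocycle_val alpha u *: transport c (pure x p) =
  tens_map (bimod_id (xi W))
    (bimod_comp c (tens_map (fun2v_hom J u) (bimod_id P))) (shuffle (s0 x) p).
Proof.
have := hom_app (astr_comp xi u) x.
rewrite transportE -!(lin_Z (@hom_linear _ _ _ _)) -(lin_Z (@pure_linearl _ _ _ _ _ _ p)).
rewrite scale_lfunE => ->; rewrite -!comp_lfunA comp_lfunE.
rewrite [in (tens_assoc _ _ _ \o _)%VF]comp_lfunA -/s0.
elim/tens_ind: (s0 x) => [w t|s t es et]; last first.
  by rewrite !homD (lin_D (@pure_linearl _ _ _ _ _ _ p)) !homD shuffleD homD es et.
rewrite /shuffle !tens_mapE !tens_assocE !tens_mapE !id_lfunE !comp_lfunE.
by rewrite tens_mapE id_lfunE.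
Qed.

(** By [transport_comp_l] and [transport_comp_r], the hypothesis says that both sides of the
    conclusion, tensored with [xi W], agree on all [shuffle (s0 x) p]. These span, as [s0] and the
    associator are bijective. *)
Lemma transport_comp :
  (transport b \o transport a)%VF = cocycle_val alpha u *: bimod_lfun (transport c) ->
  (b \o tens_map (bimod_id (fun2v_bimod J g)) a
     \o tens_assoc (fun2v_bimod J g) (fun2v_bimod J f) P)%VF =
  (c \o tens_map (fun2v_hom J u) (bimod_id P))%VF.
Proof.
move=> bac; rewrite -comp_lfunA.
apply: (@tens_faithful _ _ _ _ _ _ _
  (bimod_comp b (bimod_comp _ _)) (bimod_comp c _) (xi_inv.1 W)).
have [s0' _ s0K] : bijective s0.
  apply: lfun_comp_bij (xi_inv.2 _ _ f); apply: lfun_comp_bij.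
    exact: tens_assoc_bij.
  exact: tens_map_bij (xi_inv.2 _ _ g) (bimod_id_bij _).
have [v _ vK] :=
  tens_assoc_bij (xi W) (fun2v_bimod J g ⊗ fun2v_bimod J f) P.
apply/lfunP => t; rewrite -[t]vK.
elim/tens_ind: (v t) => [r p|r r' er er']; last by rewrite !homD er er'.
rewrite -[r]s0K -!/(shuffle _ _) -transport_comp_l -transport_comp_r.
by have := hom_app bac (pure (s0' r) p); rewrite comp_lfunE scale_lfunE.
Qed.

End Composition.

End Transport.

(** * The induced functor is an equivalence *)

Section Equivalence.

Variables (K : fieldType) (C : bicategory) (alpha : cocycle K C).

(** On the degenerate simplex [runit (id1 X)] both cocycles are 1, so the nonzero scalar is
    idempotent. *)
Lemma projrep_beta_id (rho : projrep alpha) (X : C) : projrep_beta rho (id1 X) = 1.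
Proof.
have := projrep_betaE rho (runit (id1 X) : simplex2 (id1 X) (id1 X) (id1 X)).
rewrite !cocycle_runit !mul1r => bb.
by apply: (mulfI (projrep_beta_neq0 rho (id1 X))); rewrite mulr1 -bb.
Qed.

(** Rescaling [rho] by the inverse of [beta] replaces its own cocycle by [alpha], which is the form
    [transport_comp] requires. *)
Lemma projrep_scaled_comp (rho : projrep alpha) (X Y W : C) (f : cell1 X Y)
    (g : cell1 Y W) (h : cell1 X W) (u : simplex2 f g h) v :
  (projrep_beta rho g)^-1 *: projfun_hom rho g
    ((projrep_beta rho f)^-1 *: projfun_hom rho f v) =
  cocycle_val alpha u *: ((projrep_beta rho h)^-1 *: projfun_hom rho h v).
Proof.
have := hom_app (projfun_comp rho u) v; rewrite comp_lfunE scale_lfunE => ghE.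
rewrite linearZ /= ghE !scalerA; congr (_ *: _).
have bE := projrep_betaE rho u.
have -> : cocycle_val (projfun_cocycle rho) u =
    cocycle_val alpha u * projrep_beta rho g * projrep_beta rho f / projrep_beta rho h.
  by rewrite -bE mulfK ?projrep_beta_neq0.
by field; rewrite !projrep_beta_neq0.
Qed.

Variables (J : fun2vect K C) (xi : alpha_structure alpha J).
Hypothesis xi_inv : invertible_astr xi.

Lemma induced_transport (Z : anomrep J) (X Y : C) (f : cell1 X Y) :
  induced_hom xi Z f = transport xi (anomrep_hom Z f).
Proof. by []. Qed.

Lemma induced_faithful (Z Z' : anomrep J) (h h' : anomrep_mor Z Z') :
  induced_mor xi h = induced_mor xi h' -> h = h'.
Proof.
move=> hh'; apply: anomrep_mor_eq => X.
apply: (tens_faithful (xi_inv.1 X)).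
by have := congr1 (fun k : projrep_mor (induced_projrep xi Z)
  (induced_projrep xi Z') => projrep_lfun k X) hh'.
Qed.

Lemma induced_full (Z Z' : anomrep J)
    (g : projrep_mor (induced_projrep xi Z) (induced_projrep xi Z')) :
  exists h : anomrep_mor Z Z', induced_mor xi h = g.
Proof.
have hP X : exists h : bimod_hom (Z X) (Z' X),
    bimod_lfun (tens_map (bimod_id (xi X)) h) = g X.
  have [g' <-] := base_bimod_hom (g X : 'Hom(xi X ⊗ Z X, xi X ⊗ Z' X)).
  exact: tens_full (xi_inv.1 X).
have [h hE] := dependent_choice hP.
have hnat (X Y : C) (f : cell1 X Y) : (h Y \o anomrep_hom Z f)%VF =
    (anomrep_hom Z' f \o tens_map (bimod_id (fun2v_bimod J f)) (h X))%VF.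
  (* After transport the required square becomes the naturality of [g], whose source and target both
     have [beta] equal to 1. *)
  apply: (@transport_inj _ _ _ _ _ xi_inv _ _ _ _ _
    (bimod_comp _ _) (bimod_comp _ _)).
  rewrite transport_natl transport_natr !hE -!induced_transport.
  by have := projrep_nat g f; rewrite /= invr1 !scale1r.
by exists (AnomRepMor hnat); apply: projrep_mor_eq => X; exact: hE.
Qed.

Lemma induced_ess_surj (rho : projrep alpha) :
  exists (Z : anomrep J)
    (e : @cat_hom (projrep_cat alpha) (induced_projrep xi Z) rho), is_iso e.
Proof.
have ZP X : exists Z : bimod (J X) (base_alg K),
    exists e : 'Hom(xi X ⊗ Z, rho X) * 'Hom(rho X, xi X ⊗ Z),
      cancel e.1 e.2 /\ cancel e.2 e.1.
  (* The isomorphism of [xi X ⊗ N] with [K] contracts [xi X ⊗ (N ⊗ rho X)] to [rho X]. *)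
  have [N [[e ebij] _]] := xi_inv.1 X; exists (N ⊗ vect_bimod (rho X)).
  have [c [cbij _]] := tens_contract (vect_bimod (rho X)) ebij.
  have [c' cc'] := bimod_hom_inv cbij.
  by exists (bimod_lfun c, bimod_lfun c').
have [Z {}ZP] := dependent_choice ZP; have [ee eeK] := dependent_choice ZP.
pose e X := (ee X).1; pose e' X := (ee X).2.
have eK X : cancel (e X) (e' X) := (eeK X).1.
have e'K X : cancel (e' X) (e X) := (eeK X).2.
(* The action is the preimage under [transport] of the rescaled [rho f], conjugated by [e]. Its
   axioms thus reduce to the unit and composition laws of the rescaled [rho]. *)
have [a aE] := dependent_choice (fun X => dependent_choice (fun Y =>
  dependent_choice (fun f : cell1 X Y =>
    transport_surj xi_inv f (P := Z X) (Q := Z Y)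
      (e' Y \o ((projrep_beta rho f)^-1 *: projfun_hom rho f) \o e X)%VF))).
have a_unit (X : C) : (a X X (id1 X)
    \o tens_map (fun2v_unit J X) (bimod_id (Z X)))%VF = tens_unitl (Z X).
  apply: (transport_unit xi_inv); rewrite aE projrep_beta_id projfun_id.
  by apply/lfunP => t; rewrite invr1 scale1r !comp_lfunE !id_lfunE eK.
have a_comp (X Y W : C) (f : cell1 X Y) (g : cell1 Y W) (h : cell1 X W)
    (u : simplex2 f g h) :
    (a Y W g \o tens_map (bimod_id (fun2v_bimod J g)) (a X Y f)
       \o tens_assoc (fun2v_bimod J g) (fun2v_bimod J f) (Z X))%VF =
    (a X W h \o tens_map (fun2v_hom J u) (bimod_id (Z X)))%VF.
  apply: (transport_comp xi_inv); rewrite !aE; apply/lfunP => t.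
  rewrite !comp_lfunE [RHS]scale_lfunE !comp_lfunE e'K !scale_lfunE.
  by rewrite (projrep_scaled_comp u) (lin_Z (@hom_linear _ _ _ (e' W))).
pose A := @AnomRep K C J Z a a_unit a_comp.
have e_nat (X Y : C) (f : cell1 X Y) :
    (e Y \o (1^-1 *: induced_hom xi A f))%VF =
    (((projrep_beta rho f)^-1 *: projfun_hom rho f) \o e X)%VF.
  rewrite induced_transport aE invr1 scale1r; apply/lfunP => t.
  by rewrite !comp_lfunE e'K.
have e'_nat (X Y : C) (f : cell1 X Y) :
    (e' Y \o ((projrep_beta rho f)^-1 *: projfun_hom rho f))%VF =
    ((1^-1 *: induced_hom xi A f) \o e' X)%VF.
  rewrite induced_transport aE invr1 scale1r; apply/lfunP => t.
  by rewrite !comp_lfunE e'K.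
exists A, (@ProjRepMor _ _ _ (induced_projrep xi A) rho e e_nat).
exists (@ProjRepMor _ _ _ rho (induced_projrep xi A) e' e'_nat).
by split; apply: projrep_mor_eq => X; apply/lfunP => t;
  rewrite comp_lfunE id_lfunE /= ?eK ?e'K.
Qed.

Lemma induced_equivalence :
  is_equivalence (induced xi : catfun (anomrep_cat J) (projrep_cat alpha)).
Proof.
apply: is_equivalence_ff_es.
- exact: induced_faithful.
- exact: induced_full.
- exact: induced_ess_surj.
Qed.

End Equivalence.

(** * The canonical structure on [iota_fun alpha] *)

Section IotaStructure.

Variables (K : fieldType) (C : bicategory) (alpha : cocycle K C).

Local Notation KK := (regular_bimod (base_alg K)).

Lemma iota_astr_unit (X : C) (x : KK) :
  tens_unitrV KK x = pure x (fun2v_unit (iota_fun alpha) X alg_one).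
Proof. by rewrite tens_unitrVE id_lfunE. Qed.

(** The right side carries [x] to [x ⊗ (1 ⊗ 1)], and multiplication in [iota_fun alpha] then
    contributes exactly [alpha u]. *)
Lemma iota_astr_comp (X Y Z : C) (f : cell1 X Y) (g : cell1 Y Z)
    (h : cell1 X Z) (u : simplex2 f g h) :
  cocycle_val alpha u *: bimod_lfun (tens_unitrV KK) =
  (tens_map (bimod_id KK) (fun2v_hom (iota_fun alpha) u)
     \o tens_assoc KK KK KK \o tens_map (tens_unitrV KK) (bimod_id KK)
     \o tens_unitrV KK)%VF.
Proof.
apply/lfunP => x; rewrite scale_lfunE !comp_lfunE !tens_unitrVE.
rewrite tens_mapE tens_unitrVE id_lfunE tens_assocE tens_mapE id_lfunE.
by rewrite iota_homE alg_mul1l (lin_Z (@pure_linearr _ _ _ _ _ _ _)).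
Qed.

(** This is the identity transformation of [iota_fun alpha], up to unitors. *)
Definition iota_astr : alpha_structure alpha (iota_fun alpha) :=
  @AlphaStructure K C alpha (iota_fun alpha) (fun _ => KK)
    (fun _ _ _ => tens_unitrV KK) iota_astr_unit iota_astr_comp.

Lemma iota_astr_invertible : invertible_astr iota_astr.
Proof.
split=> [X|X Y f]; last exact: tens_unitrV_bij.
(* [K] is its own inverse, so the same unitor serves both orders of the product. *)
by exists KK; split; exists (tens_unitl KK); exact: tens_unitl_bij.
Qed.

End IotaStructure.

Theorem proposition5p6 (K : fieldType) (C : bicategory) (alpha : cocycle K C) :
  equivalent (projrep_cat alpha) (anomrep_cat (iota_fun alpha)) /\
  (forall (J : fun2vect K C) (xi : alpha_structure alpha J),
     invertible_astr xi ->
     is_equivalence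
       (induced xi : catfun (anomrep_cat J) (projrep_cat alpha))).
Proof.
split; last by move=> J xi; apply: induced_equivalence.
(* The first claim is the case of [iota_astr], with the equivalence reversed. *)
exact/is_equivalence_equivalent/induced_equivalence/iota_astr_invertible.
Qed.
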